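(* For each $n$ let $A_n$ be the adjacency matrix of the inhomogeneous Erdős–Rényi random graph $\mathcal G(n,(p_{ij}))$ on vertex set $[n]$, where the edges $ij$ exist independently with given probabilities $p_{ij}=p_{ji}$ (which may depend on $n$). Assume there is $\alpha=\alpha(n)$ with $\alpha\to0$ and $\alpha=\omega(1/n)$ as $n\to\infty$ such that $$\sum_{i=1}^np_{ij}=(1+o(1))\,n\alpha\quad\text{for all }j\in[n]$$ (with $o(1)\to 0$ uniformly in $j$), and $$\max_{ij}p_{ij}\le C\alpha\quad\text{for some constant }C\ge1 .$$ Then the empirical spectral distribution of the scaled adjacency matrix $\frac{A_n}{\sqrt{n\alpha}}$ converges almost surely to the semicircle law.
   Context: $\alpha=\omega(1/n)$ means $n\alpha\to\infty$. The empirical spectral distribution of an $n\times n$ Hermitian matrix $A$ with eigenvalues $\lambda_1,\dots,\lambda_n$ is $F^A(x)=\frac1n\sum_{i=1}^n\mathbf 1_{\{\lambda_i\le x\}}$. The semicircle law is the probability measure with density $\frac1{2\pi}\sqrt{4-x^2}$ on $[-2,2]$. All the random graphs are defined on a common probability space, and almost sure convergence means that almost surely the empirical spectral distributions converge weakly. *)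

(* Defs.v *)
From HB Require Import structures.
From mathcomp Require Import all_boot all_order all_algebra.
From mathcomp Require Import complex.
From mathcomp Require Import all_classical all_reals all_analysis.

Set Implicit Arguments.
Unset Strict Implicit.
Unset Printing Implicit Defensive.

Import Order.TTheory GRing.Theory Num.Theory.
Import numFieldNormedType.Exports.

Local Open Scope classical_set_scope.
Local Open Scope ring_scope.
Local Open Scope complex_scope.

(* For Hermitian [A], [spectral_diag A] lists the [n] eigenvalues of [A] with
   multiplicity, all of them real; [<=] on [R[i]] is then the order of [R]. *)
Definition esd (R : realType) (n : nat) (A : 'M[R[i]]_n) (x : R) : R :=
  n%:R^-1 * \sum_(i < n) (spectral_diag A 0 i <= x%:C)%R%:R.

Definition semicircle_density (R : realType) (x : R) : R :=
  \1_(`[-2, 2] : set R) x * ((2 * pi)^-1 * Num.sqrt (4 - x ^+ 2)).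

Definition semicircle_law (R : realType) (V : set R) : \bar R :=
  (\int[lebesgue_measure]_(x in V) (semicircle_density x)%:E)%E.

Definition semicircle_cdf (R : realType) (x : R) : R :=
  fine (semicircle_law (`]-oo, x] : set R)).

(* Weak convergence of probability measures on the line, in terms of their
   distribution functions. *)
Definition weak_cvg (R : realType) (F : nat -> R -> R) (F0 : R -> R) : Prop :=
  forall x : R, {for x, continuous F0} -> F n x @[n --> \oo] --> F0 x.

Definition independent_events (d : measure_display) (T : measurableType d)
    (R : realType) (P : probability T R) (I : finType) (D : {set I})
    (E : I -> set T) : Prop :=
  forall J : {set I}, J \subset D ->
    P (\bigcap_(i in [set` J]) E i) = (\prod_(i in J) P (E i))%E.

Definition edge_event (T : Type) (n : nat) (G : T -> rel 'I_n)
    (e : 'I_n * 'I_n) : set T :=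
  [set w | G w e.1 e.2].

(* [G] is a random simple graph, so the diagonal entries of [p] play no role
   in its law. *)
Record inhomogeneous_ER (d : measure_display) (T : measurableType d)
    (R : realType) (P : probability T R) (n : nat) (p : 'I_n -> 'I_n -> R)
    (G : T -> rel 'I_n) : Prop := InhomogeneousER {
  ER_sym : forall w : T, symmetric (G w) ;
  ER_irr : forall w : T, irreflexive (G w) ;
  ER_meas : forall i j : 'I_n, measurable (edge_event G (i, j)) ;
  ER_prob : forall i j : 'I_n, (i < j)%N -> P (edge_event G (i, j)) = (p i j)%:E ;
  ER_indep : independent_events P
    [set e : 'I_n * 'I_n | (e.1 < e.2)%N]%SET (edge_event G) }.

Definition adjacency (R : realType) (n : nat) (g : rel 'I_n) : 'M[R[i]]_n :=
  \matrix_(i, j) (g i j)%:R.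

(* Main.v *)
Require Import Defs.
From HB Require Import structures.
From mathcomp Require Import all_boot all_order all_algebra.
From mathcomp Require Import complex.
From mathcomp Require Import all_classical all_reals all_analysis.
From mathcomp Require Import ring lra.

(* Let h = (n alpha)^(-1/2), H = h A, G = (H - z)^-1 with z = x + i eta and
   eta > 0 fixed, s_ij = h^2 p_ij, so that the rows of s sum to 1 + o(1), and let
   m be the solution of m (z + m) = -1 in the upper half plane.

   Averaging over one edge at a time in (H G)_ii = z G_ii + 1 shows that
   D_i = z G_ii + 1 + G_ii sum_j s_ij G_jj is O(sqrt alpha + h)^(1/2) in L^2,
   uniformly in i; no centering of A is needed, because its mean only contributes
   sum_j h p_ij |G_ij| = O(sqrt alpha). The system D = 0 is stable at m for every
   eta > 0, since |m| < 1 and s is symmetric, so the expected mean of the G_ii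
   tends to m. As eta -> 0, Im m(x + i eta) tends to sqrt(4 - x^2) / 2 locally
   uniformly; integrating in x replaces Im tr G by arctangents of the eigenvalues,
   which are smoothed indicators.

   Flipping an edge changes such a statistic by O(h / n), and there are about
   n / h^2 edges, so its fourth central moment is O(n^-2). This is summable no
   matter how slowly n alpha grows, and Borel-Cantelli gives almost sure
   convergence for countably many smoothing parameters. The mass escaping to
   infinity is controlled by tr H^2 / n, a multiple of the number of edges. *)

Set Implicit Arguments.
Unset Strict Implicit.
Unset Printing Implicit Defensive.

Import Order.TTheory GRing.Theory Num.Theory.
Import numFieldNormedType.Exports.
Import Normc.

Local Open Scope classical_set_scope.
Local Open Scope ring_scope.
Local Open Scope complex_scope.

(** * Product Bernoulli measures on a cube *)

(** Two obstacles shape the proof. For small [eta] the map m -> -1 / (z + m) is no useful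
    contraction in the sup norm, because the intermediate quantities are bounded only by 1 / eta.
    The way out is to measure the error against weights: the imaginary parts of an exact solution of
    a perturbed equation. Cauchy-Schwarz with these weights leaves the factor |m|^2 alone.
    Concentration has a similar difficulty. An inequality that charges every pair of vertices the
    same amount gives tails of order exp(-c n alpha), which need not be summable. Here each pair is
    charged its own edge probability, which gains the factor alpha. All expectations are finite sums
    over edge configurations. Measure theory enters only when the law of the graph is identified and
    in Borel-Cantelli, and integration in x becomes the mean value inequality for
    antiderivatives. *)

Section ProductBernoulli.
Variables (R : realFieldType) (I : finType) (q : I -> R).
Implicit Types (e : I) (g : {ffun I -> bool}) (f : {ffun I -> bool} -> R).

Definition config_weight g : R := \prod_e (if g e then q e else 1 - q e).

Definition expect f : R := \sum_g config_weight g * f g.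

Definition set_coord g e (b : bool) : {ffun I -> bool} :=
  [ffun x => if x == e then b else g x].

(** Conditional expectation of [f] given all coordinates other than [e]. *)
Definition resample e f g : R :=
  q e * f (set_coord g e true) + (1 - q e) * f (set_coord g e false).

Lemma set_coordE g e b x : set_coord g e b x = if x == e then b else g x.
Proof. by rewrite ffunE. Qed.

Lemma set_coord_id g e : set_coord g e (g e) = g.
Proof. by apply/ffunP => x; rewrite ffunE; case: eqP => // ->. Qed.

Lemma set_coord_set g e b c : set_coord (set_coord g e b) e c = set_coord g e c.
Proof. by apply/ffunP => x; rewrite !ffunE; case: eqP. Qed.

Lemma set_coordC g e e' b c : e != e' ->
  set_coord (set_coord g e b) e' c = set_coord (set_coord g e' c) e b.
Proof.
move=> /negbTE ee'; apply/ffunP => x; rewrite !ffunE.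
case: (eqVneq x e') => [->|//]; by rewrite eq_sym ee'.
Qed.

Lemma config_weight_set g e b : config_weight (set_coord g e b) =
  (if b then q e else 1 - q e) *
  \prod_(x | x != e) (if g x then q x else 1 - q x).
Proof.
rewrite /config_weight (bigD1 e)//= set_coordE eqxx; congr (_ * _).
by apply: eq_bigr => x xe; rewrite set_coordE (negbTE xe).
Qed.

(** Configurations are paired by flipping coordinate [e]; each pair is represented by its member
    with [g e] true. *)
Lemma expect_split e f : expect f =
  \sum_(g : {ffun I -> bool} | g e) (\prod_(x | x != e) (if g x then q x else 1 - q x)) *
     resample e f g.
Proof.
rewrite /expect (bigID (fun g : {ffun I -> bool} => g e))/=.
rewrite [X in _ + X](reindex_onto (fun g : {ffun I -> bool} => set_coord g e false) (fun g : {ffun I -> bool} => set_coord g e true))/=;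
  last first.
  by move=> g ge; rewrite set_coord_set -(negbTE ge) set_coord_id.
have H (g : {ffun I -> bool}) : (~~ set_coord g e false e &&
    (set_coord (set_coord g e false) e true == g)) = g e.
  rewrite set_coordE eqxx/= set_coord_set; apply/eqP/idP => [<-|ge].
    by rewrite set_coordE eqxx.
  by rewrite -[RHS](set_coord_id g e) ge.
rewrite (eq_bigl _ _ H) -big_split/=; apply: eq_bigr => g ge.
rewrite /resample config_weight_set.
rewrite -{1 2}(set_coord_id g e) ge config_weight_set.
ring.
Qed.

Lemma resample_set e f g b : resample e f (set_coord g e b) = resample e f g.
Proof. by rewrite /resample !set_coord_set. Qed.

Lemma expect_resample e f : expect (resample e f) = expect f.
Proof.
rewrite !(expect_split e); apply: eq_bigr => g _; congr (_ * _).
by rewrite /resample !set_coord_set; ring.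
Qed.

Lemma eq_expect f1 f2 : f1 =1 f2 -> expect f1 = expect f2.
Proof. by move=> ff; apply: eq_bigr => g _; rewrite ff. Qed.

Lemma expectD f1 f2 : expect (fun g => f1 g + f2 g) = expect f1 + expect f2.
Proof. by rewrite /expect -big_split/=; apply: eq_bigr => g _; rewrite mulrDr. Qed.

Lemma expectZ a f : expect (fun g => a * f g) = a * expect f.
Proof. by rewrite /expect mulr_sumr; apply: eq_bigr => g _; rewrite mulrCA. Qed.

Lemma expect_sum (J : finType) (F : J -> {ffun I -> bool} -> R) :
  expect (fun g => \sum_j F j g) = \sum_j expect (F j).
Proof.
by rewrite /expect exchange_big/=; apply: eq_bigr => g _; rewrite mulr_sumr.
Qed.

Lemma expect_cst a : expect (fun=> a) = a.
Proof.
rewrite /expect -mulr_suml [X in X * _](_ : _ = 1) ?mul1r//.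
rewrite /config_weight.
rewrite -(bigA_distr_bigA (fun e (b : bool) => if b then q e else 1 - q e)).
by apply: big1 => e _; rewrite big_bool/= addrC subrK.
Qed.

Lemma expect_coord e f :
  expect (fun g => (g e)%:R * f g) = q e * expect (fun g => f (set_coord g e true)).
Proof.
rewrite -(expect_resample e) -expectZ; apply: eq_expect => g.
by rewrite /resample !set_coordE eqxx mul1r mul0r mulr0 addr0.
Qed.

Hypothesis q01 : forall e, 0 <= q e <= 1.

Lemma config_weight_ge0 g : 0 <= config_weight g.
Proof.
apply: prodr_ge0 => e _; have /andP[q0 q1] := q01 e.
by case: ifP => _ //; rewrite subr_ge0.
Qed.

Lemma ler_expect f1 f2 : (forall g, f1 g <= f2 g) -> expect f1 <= expect f2.
Proof. by move=> ff; apply: ler_sum => g _; rewrite ler_wpM2l ?config_weight_ge0. Qed.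

Lemma ler_norm_expect f : `|expect f| <= expect (fun g => `|f g|).
Proof.
apply: (le_trans (ler_norm_sum _ _ _)); apply: ler_sum => g _.
by rewrite normrM ger0_norm// config_weight_ge0.
Qed.

(** * Moments of Lipschitz statistics by averaging one coordinate at a time *)

Definition resample_seq (s : seq I) f := foldl (fun f e => resample e f) f s.

Definition free_of e f := forall g b, f (set_coord g e b) = f g.

Lemma free_of_resample e e' f : free_of e f -> free_of e (resample e' f).
Proof.
move=> fe g b; rewrite /resample; have [->|ee'] := eqVneq e e'.
  by rewrite !set_coord_set.
by rewrite !(set_coordC _ _ _ ee') !fe.
Qed.

Lemma free_of_resample_seq e s f : free_of e f -> free_of e (resample_seq s f).
Proof.
elim: s f => [|e' s IH] f fe //=.
by apply: IH; apply: free_of_resample.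
Qed.

Lemma free_of_resample_seq_mem e s f : e \in s -> free_of e (resample_seq s f).
Proof.
elim: s f => [|e' s IH] f //=; rewrite inE => /orP[/eqP ->|]; last exact: IH.
by apply: free_of_resample_seq => g b; exact: resample_set.
Qed.

(** Once every coordinate has been averaged the function depends on none of them. It is then
    constant, equal to its own mean, and averaging preserves the mean. *)
Lemma resample_seq_enum f g : resample_seq (enum I) f g = expect f.
Proof.
pose F := resample_seq (enum I) f.
have Ffree e : free_of e F by apply: free_of_resample_seq_mem; rewrite mem_enum.
have Fcst g1 g2 : F g1 = F g2.
  (* [mix] passes from [g1] to [g2] one coordinate at a time. *)
  pose mix (s : seq I) := [ffun x => if x \in s then g2 x else g1 x].
  have H s : F (mix s) = F g1.
    elim: s => [|e s IH]; first by congr F; apply/ffunP => x; rewrite ffunE.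
    rewrite -IH (_ : mix (e :: s) = set_coord (mix s) e (g2 e)) ?Ffree//.
    by apply/ffunP => x; rewrite !ffunE in_cons; case: eqP => // ->.
  rewrite -(H (enum I)); congr F; apply/ffunP => x.
  by rewrite ffunE mem_enum inE.
have -> : expect f = expect F.
  by rewrite /F /resample_seq; elim: (enum I) f {F Ffree Fcst} => //= e s IH f;
    rewrite -IH expect_resample.
by rewrite (eq_expect (fun g' => Fcst g' g)) expect_cst.
Qed.

Definition flip_lipschitz (c : R) f := forall g e,
  `|f (set_coord g e true) - f (set_coord g e false)| <= c.

Lemma flip_lipschitz_resample c e f :
  flip_lipschitz c f -> flip_lipschitz c (resample e f).
Proof.
move=> fc g e'; rewrite /resample; have [->|ee'] := eqVneq e' e.
  rewrite !set_coord_set subrr normr0; exact: le_trans (fc g e).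
rewrite !(set_coordC _ _ _ ee').
set a1 := f _; set a2 := f _; set a3 := f _; set a4 := f _.
have -> : q e * a1 + (1 - q e) * a2 - (q e * a3 + (1 - q e) * a4) =
   q e * (a1 - a3) + (1 - q e) * (a2 - a4) by ring.
have /andP[q0 q1] := q01 e.
apply: (le_trans (ler_normD _ _)); rewrite !normrM (ger0_norm q0) (@ger0_norm _ (1 - _)) ?subr_ge0//.
have h1 : `|a1 - a3| <= c by exact: fc.
have h2 : `|a2 - a4| <= c by exact: fc.
have -> : c = q e * c + (1 - q e) * c by ring.
by rewrite lerD// ler_wpM2l// subr_ge0.
Qed.

(** The centred two-point increment is orthogonal to [z] and has variance p (1 - p) (f1 - f0)^2. The
    factor p is kept: summed over all pairs it counts expected edges instead of pairs. *)
Lemma var_poly (p c z f1 f0 : R) : 0 <= p <= 1 -> (f1 - f0) ^+ 2 <= c ^+ 2 ->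
  let Tf := p * f1 + (1 - p) * f0 in
  p * (f1 - Tf + z) ^+ 2 + (1 - p) * (f0 - Tf + z) ^+ 2 <= z ^+ 2 + p * c ^+ 2.
Proof.
move=> /andP[p0 p1] dc /=.
have -> : p * (f1 - (p * f1 + (1 - p) * f0) + z) ^+ 2 +
  (1 - p) * (f0 - (p * f1 + (1 - p) * f0) + z) ^+ 2 =
  z ^+ 2 + p * ((1 - p) * (f1 - f0) ^+ 2) by ring.
rewrite lerD2l ler_wpM2l//; apply: le_trans dc.
rewrite -[leRHS]mul1r ler_wpM2r ?sqr_ge0//; lra.
Qed.

(** The term linear in the increment averages out, so the growth of z^4 is again of order p. The
    mixed cubic term is split between its two neighbours, whence 8 = 6 + 2 and 3 = 2 + 1. *)
Lemma fourth_poly (p c z f1 f0 : R) : 0 <= p <= 1 -> (f1 - f0) ^+ 2 <= c ^+ 2 ->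
  let Tf := p * f1 + (1 - p) * f0 in
  p * (f1 - Tf + z) ^+ 4 + (1 - p) * (f0 - Tf + z) ^+ 4 <=
  z ^+ 4 + p * (8 * c ^+ 2 * z ^+ 2 + 3 * c ^+ 4).
Proof.
move=> /andP[p0 p1] dc /=; set d := f1 - f0 in dc *.
have -> : f1 - (p * f1 + (1 - p) * f0) = (1 - p) * d by rewrite /d; ring.
have -> : f0 - (p * f1 + (1 - p) * f0) = - p * d by rewrite /d; ring.
have d4 : d ^+ 4 <= c ^+ 4.
  by rewrite -[4%N]/(2 * 2)%N !exprM lerXn2r// ?nnegrE ?sqr_ge0.
set u := p * (1 - p).
have u0 : 0 <= u by rewrite mulr_ge0// subr_ge0.
have -> : p * ((1 - p) * d + z) ^+ 4 + (1 - p) * (- p * d + z) ^+ 4 =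
  z ^+ 4 + u * (6 * d ^+ 2 * z ^+ 2 + 4 * (1 - 2 * p) * d ^+ 3 * z
    + (1 - 3 * p + 3 * p ^+ 2) * d ^+ 4) by rewrite /u; ring.
rewrite lerD2l.
have b1 : 4 * (1 - 2 * p) * d ^+ 3 * z <= 2 * d ^+ 2 * z ^+ 2 + 2 * d ^+ 4.
  rewrite -subr_ge0.
  (* Completing the square, with 1 - (1 - 2 p)^2 = 4 p (1 - p). *)
  have -> : 2 * d ^+ 2 * z ^+ 2 + 2 * d ^+ 4 - 4 * (1 - 2 * p) * d ^+ 3 * z =
    2 * d ^+ 2 * ((z - (1 - 2 * p) * d) ^+ 2 + 4 * (p * (1 - p)) * d ^+ 2) by ring.
  apply: mulr_ge0; first by rewrite mulr_ge0// sqr_ge0.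
  by rewrite addr_ge0 ?sqr_ge0// mulr_ge0 ?sqr_ge0// mulr_ge0.
have b2 : (1 - 3 * p + 3 * p ^+ 2) * d ^+ 4 <= d ^+ 4.
  rewrite -[leRHS]mul1r ler_wpM2r//; first by rewrite -[4%N]/(2 * 2)%N exprM sqr_ge0.
  move: u0; rewrite /u; nra.
have b3 : d ^+ 2 * z ^+ 2 <= c ^+ 2 * z ^+ 2 by rewrite ler_wpM2r ?sqr_ge0.
have b : 6 * d ^+ 2 * z ^+ 2 + 4 * (1 - 2 * p) * d ^+ 3 * z
    + (1 - 3 * p + 3 * p ^+ 2) * d ^+ 4 <= 8 * c ^+ 2 * z ^+ 2 + 3 * c ^+ 4.
  by rewrite -!mulrA in b1 b2 b3 *; lra.
apply: (le_trans (ler_wpM2l u0 b)).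
rewrite ler_wpM2r//.
  apply: addr_ge0; last by rewrite mulr_ge0// -[4%N]/(2 * 2)%N exprM sqr_ge0.
  by rewrite mulr_ge0 ?sqr_ge0// mulr_ge0 ?sqr_ge0.
by rewrite /u -[leRHS]mulr1 ler_wpM2l//; lra.
Qed.

(** Martingale decomposition: the difference is the increment at [e] plus a remainder [Z] that is
    free of [e]. Both moments go through one induction, since the step for the fourth moment
    involves the second moment of [Z]. *)
Lemma resample_seq_moments c s f : flip_lipschitz c f ->
  expect (fun g => (f g - resample_seq s f g) ^+ 2) <= c ^+ 2 * \sum_(e <- s) q e /\
  expect (fun g => (f g - resample_seq s f g) ^+ 4) <=
    8 * (c ^+ 2 * \sum_(e <- s) q e) ^+ 2 + 3 * c ^+ 4 * \sum_(e <- s) q e.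
Proof.
elim: s f => [|e s IH] f fc.
  rewrite !big_nil !mulr0 expr0n/= mulr0 addr0.
  by split; rewrite (eq_expect (f2 := fun=> 0)) ?expect_cst// => g;
    rewrite /= subrr expr0n.
have fc' := flip_lipschitz_resample e fc.
have [IH2 IH4] := IH _ fc'.
rewrite big_cons /=; set Q := \sum_(e <- s) q e in IH2 IH4 *.
have Q0 : 0 <= Q by apply: sumr_ge0 => x _; have /andP[] := q01 x.
have /andP[q0 q1] := q01 e.
pose Z g := resample e f g - resample_seq s (resample e f) g.
have rs_free g b : resample_seq s (resample e f) (set_coord g e b) =
    resample_seq s (resample e f) g.
  by apply: free_of_resample_seq => g' b'; exact: resample_set.
have step k g : resample e (fun g => (f g - resample_seq s (resample e f) g) ^+ k) g =
  q e * (f (set_coord g e true) - resample e f g + Z g) ^+ k +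
  (1 - q e) * (f (set_coord g e false) - resample e f g + Z g) ^+ k.
  have ZE x : f x - resample e f g + Z g = f x - resample_seq s (resample e f) g.
    by rewrite /Z; ring.
  by rewrite {1}/resample !rs_free !ZE.
have dc g : (f (set_coord g e true) - f (set_coord g e false)) ^+ 2 <= c ^+ 2.
  by rewrite -real_normK ?num_real// lerXn2r ?nnegrE//; exact: le_trans (fc g e).
split.
- rewrite -(expect_resample e).
  apply: (@le_trans _ _ (expect (fun g => Z g ^+ 2 + q e * c ^+ 2))).
    apply: ler_expect => g; rewrite step.
    by apply: var_poly => //; exact: q01.
  rewrite expectD expect_cst.
  by move: IH2; rewrite mulrDr addrC [q e * _]mulrC; apply: lerD.
- rewrite -(expect_resample e).
  apply: (@le_trans _ _ (expect (fun g => Z g ^+ 4 + (8 * q e * c ^+ 2 * Z g ^+ 2 +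
     3 * q e * c ^+ 4)))).
    apply: ler_expect => g; rewrite step.
    apply: le_trans (@fourth_poly _ c _ _ _ (q01 e) (dc g)) _.
    by rewrite le_eqVlt; apply/orP; left; apply/eqP; ring.
  rewrite !expectD expectZ expect_cst.
  set A := expect _ in IH2 *; set B := expect _ in IH4 *.
  have h1 : 8 * q e * c ^+ 2 * A <= 8 * q e * c ^+ 2 * (c ^+ 2 * Q).
    by rewrite ler_wpM2l// mulr_ge0 ?sqr_ge0// mulr_ge0.
  apply: le_trans (lerD IH4 (lerD h1 (lexx _))) _.
  rewrite -subr_ge0.
  (* Expanding (q e + Q)^2 supplies twice the cross term that has to be absorbed. *)
  have -> : 8 * (c ^+ 2 * (q e + Q)) ^+ 2 + 3 * c ^+ 4 * (q e + Q) -
   (8 * (c ^+ 2 * Q) ^+ 2 + 3 * c ^+ 4 * Q +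
    (8 * q e * c ^+ 2 * (c ^+ 2 * Q) + 3 * q e * c ^+ 4)) =
    8 * (c ^+ 2) ^+ 2 * (q e * Q + q e ^+ 2) by ring.
  apply: mulr_ge0; first by rewrite mulr_ge0// sqr_ge0.
  by rewrite addr_ge0 ?sqr_ge0// mulr_ge0.
Qed.

Lemma expect_fourth_moment c f : flip_lipschitz c f ->
  expect (fun g => (f g - expect f) ^+ 4) <=
    8 * (c ^+ 2 * \sum_e q e) ^+ 2 + 3 * c ^+ 4 * \sum_e q e.
Proof.
move=> fc; have [_] := resample_seq_moments (enum I) fc.
rewrite big_enum/=; congr (_ <= _); apply: eq_expect => g.
by rewrite resample_seq_enum.
Qed.

End ProductBernoulli.

(** * Complex modulus and resolvents *)

Section ComplexModulus.
Variable R : rcfType.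
Implicit Types (x y z : R[i]) (a : R).

Lemma ReD x y : complex.Re (x + y) = complex.Re x + complex.Re y.
Proof. by case: x; case: y. Qed.

Lemma ImD x y : complex.Im (x + y) = complex.Im x + complex.Im y.
Proof. by case: x; case: y. Qed.

Lemma ReN x : complex.Re (- x) = - complex.Re x. Proof. by case: x. Qed.

Lemma ImN x : complex.Im (- x) = - complex.Im x. Proof. by case: x. Qed.

Lemma Re_sum (I : finType) (F : I -> R[i]) :
  complex.Re (\sum_i F i) = \sum_i complex.Re (F i).
Proof. exact: (big_morph _ ReD). Qed.

Lemma Im_sum (I : finType) (F : I -> R[i]) :
  complex.Im (\sum_i F i) = \sum_i complex.Im (F i).
Proof. exact: (big_morph _ ImD). Qed.

Lemma ReZ a x : complex.Re (a%:C * x) = a * complex.Re x.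
Proof. by case: x => b c /=; rewrite mul0r subr0. Qed.

Lemma ImZ a x : complex.Im (a%:C * x) = a * complex.Im x.
Proof. by case: x => b c /=; rewrite mul0r addr0. Qed.

Lemma normc_ge0 x : 0 <= normc x.
Proof. by case: x => a b; exact: sqrtr_ge0. Qed.

Lemma sqr_normc x : normc x ^+ 2 = complex.Re x ^+ 2 + complex.Im x ^+ 2.
Proof. by case: x => a b; rewrite /= sqr_sqrtr// addr_ge0// sqr_ge0. Qed.

Lemma normc_real a : normc a%:C = `|a|.
Proof. by rewrite /= expr0n/= addr0 sqrtr_sqr. Qed.

Lemma normcZ a x : 0 <= a -> normc (a%:C * x) = a * normc x.
Proof. by move=> a0; rewrite normcM normc_real ger0_norm. Qed.

Lemma ler_normcD x y : normc (x + y) <= normc x + normc y.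
Proof. exact: (@le_normcD R). Qed.

Lemma normc_opp x : normc (- x) = normc x.
Proof. exact: (@normcN R). Qed.

Lemma ler_normcB x y : normc (x - y) <= normc x + normc y.
Proof. by rewrite -(normc_opp y) ler_normcD. Qed.

Lemma normc_distC x y : normc (x - y) = normc (y - x).
Proof. by rewrite -normc_opp opprB. Qed.

Lemma ler_normc_sum (I : finType) (F : I -> R[i]) :
  normc (\sum_i F i) <= \sum_i normc (F i).
Proof.
apply: (big_ind2 (fun (x : R[i]) (y : R) => normc x <= y)) => //.
  by rewrite normc0.
by move=> x a y b xa yb; apply: (le_trans (ler_normcD _ _)); exact: lerD.
Qed.

Lemma Im_le_normc x : `|complex.Im x| <= normc x.
Proof.
rewrite -(@ler_pXn2r _ 2)// ?nnegrE ?normc_ge0// sqr_normc real_normK ?num_real//.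
by rewrite lerDr sqr_ge0.
Qed.

Lemma Re_le_normc x : `|complex.Re x| <= normc x.
Proof.
rewrite -(@ler_pXn2r _ 2)// ?nnegrE ?normc_ge0// sqr_normc real_normK ?num_real//.
by rewrite lerDl sqr_ge0.
Qed.

Lemma normcJ x : normc x^* = normc x.
Proof. by case: x => a b /=; rewrite sqrrN. Qed.

Lemma mulcJ x : x * x^* = (normc x ^+ 2)%:C.
Proof.
rewrite sqr_normc; case: x => a b /=; apply/eqP; rewrite eq_complex/=.
by apply/andP; split; apply/eqP; ring.
Qed.

Lemma normc_inv_le x a : 0 < a -> a <= `|complex.Im x| -> normc x^-1 <= a^-1.
Proof.
move=> a0 ax; have := le_trans ax (Im_le_normc x) => ax'.
by rewrite normcV lef_pV2// posrE// (lt_le_trans a0).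
Qed.

Lemma Im_inv x : complex.Im x^-1 = - complex.Im x / normc x ^+ 2.
Proof. by rewrite sqr_normc; case: x => a b /=; rewrite mulNr. Qed.

End ComplexModulus.

Lemma mulmx_delta_mx (C : comNzRingType) (n : nat) (M N : 'M[C]_n) (i j a b : 'I_n) :
  (M *m delta_mx i j *m N) a b = M a i * N j b.
Proof.
rewrite !mxE (bigD1 j)//= [X in _ + X]big1 ?addr0; last first.
  move=> k kj; rewrite !mxE big1 ?mul0r// => l _.
  by rewrite !mxE (negbTE kj) andbF mulr0.
congr (_ * _); rewrite !mxE (bigD1 i)//= big1 ?addr0; last first.
  by move=> k ki; rewrite !mxE (negbTE ki) mulr0.
by rewrite !mxE !eqxx mulr1.
Qed.

Lemma conj_diag_mxV (C : fieldType) (n : nat) (U : 'M[C]_n) (d e : 'rV[C]_n) :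
  U \in unitmx -> (forall i, d 0 i * e 0 i = 1) ->
  (invmx U *m diag_mx d *m U) *m (invmx U *m diag_mx e *m U) = 1%:M.
Proof.
move=> Uu de; rewrite !mulmxA mulmxK// -(mulmxA (invmx U)) mulmx_diag.
rewrite (_ : diag_mx _ = 1%:M) ?mulmx1 ?mulVmx//.
by apply/matrixP => i j; rewrite !mxE de.
Qed.

Section Resolvent.
Variables (R : rcfType) (n : nat).
Implicit Types (A B : 'M[R]_n) (z : R[i]).

Definition cmx A : 'M[R[i]]_n := map_mx (real_complex R) A.

Definition eigval A (i : 'I_n) : R := complex.Re (spectral_diag (cmx A) 0 i).

Definition resolvent A z : 'M[R[i]]_n := invmx (cmx A - z%:M).

Lemma spectral_sym A : A^T = A ->
  (forall i, spectral_diag (cmx A) 0 i = (eigval A i)%:C) /\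
  cmx A = invmx (spectralmx (cmx A)) *m diag_mx (\row_i (eigval A i)%:C) *m
          spectralmx (cmx A).
Proof.
move=> As.
have Ah : cmx A \is hermsymmx.
  apply: realsym_hermsym.
    by apply/is_hermitianmxP; rewrite expr0 scale1r map_mx_id// /cmx map_trmx As.
  by apply/mxOverP => i j; rewrite mxE complex_real.
have E i : spectral_diag (cmx A) 0 i = (eigval A i)%:C.
  by have /mxOverP/(_ 0 i)/RRe_real := hermitian_spectral_diag_real Ah.
split=> //.
have -> : \row_i (eigval A i)%:C = spectral_diag (cmx A).
  by apply/rowP => i; rewrite mxE E.
exact/orthomx_spectralP/hermitian_normalmx.
Qed.

Section Symmetric.
Variables (A : 'M[R]_n) (z : R[i]).
Hypotheses (As : A^T = A) (z0 : complex.Im z != 0).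

Lemma real_sub_neq0 (a : R) : a%:C - z != 0.
Proof.
apply: contra z0 => /eqP/(congr1 (@complex.Im R)); rewrite ImD ImN/= => /eqP.
by rewrite add0r oppr_eq0.
Qed.

Let U := spectralmx (cmx A).
Let Uu : U \in unitmx. Proof. exact: spectral_unit. Qed.

Lemma shift_spectral : cmx A - z%:M =
  invmx U *m diag_mx (\row_i ((eigval A i)%:C - z)) *m U.
Proof.
have [_ {1}->] := spectral_sym As.
have -> : diag_mx (\row_i ((eigval A i)%:C - z)) =
  diag_mx (\row_i (eigval A i)%:C) - z%:M.
  by apply/matrixP => i j; rewrite !mxE; case: eqP; rewrite ?mulr1n ?mulr0n ?subr0.
rewrite mulmxBr mulmxBl; congr (_ - _).
by rewrite mul_mx_scalar -scalemxAl mulVmx// scalemx1.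
Qed.

Lemma resolvent_spectral : (cmx A - z%:M) *m
  (invmx U *m diag_mx (\row_i ((eigval A i)%:C - z)^-1) *m U) = 1%:M.
Proof.
rewrite shift_spectral; apply: conj_diag_mxV => // i.
by rewrite !mxE mulfV// real_sub_neq0.
Qed.

Lemma shift_unit : cmx A - z%:M \in unitmx.
Proof. by have [] := mulmx1_unit resolvent_spectral. Qed.

Lemma tr_resolvent : \tr (resolvent A z) = \sum_i ((eigval A i)%:C - z)^-1.
Proof.
have -> : resolvent A z = invmx U *m diag_mx (\row_i ((eigval A i)%:C - z)^-1) *m U.
  by apply: (can_inj (mulKmx shift_unit)); rewrite resolvent_spectral mulmxV// shift_unit.
rewrite mxtrace_mulC mulmxA mulmxV// mul1mx mxtrace_diag.
by apply: eq_bigr => i _; rewrite mxE.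
Qed.

Lemma resolvent_sym i j : resolvent A z i j = resolvent A z j i.
Proof.
have : (resolvent A z)^T = resolvent A z.
  by rewrite /resolvent trmx_inv linearB/= tr_scalar_mx /cmx map_trmx As.
by move=> /matrixP/(_ j i); rewrite mxE.
Qed.

Lemma resolvent_row i : z * resolvent A z i i + 1 =
  \sum_j (A i j)%:C * resolvent A z j i.
Proof.
have /matrixP/(_ i i) : (cmx A - z%:M) *m resolvent A z = 1%:M by rewrite mulmxV ?shift_unit.
rewrite mulmxBl mul_scalar_mx !mxE eqxx mulr1n => /eqP; rewrite subr_eq => /eqP E.
rewrite addrC -E; apply: eq_bigr => j _; by rewrite mxE.
Qed.

Lemma resolvent_conj : map_mx conjc (resolvent A z) = resolvent A z^*.
Proof.
rewrite /resolvent map_invmx; congr invmx; apply/matrixP => i j; rewrite !mxE.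
by rewrite rmorphB rmorphMn; congr (_ - _); rewrite /= oppr0.
Qed.

End Symmetric.

Lemma resolvent_sub A B z : A^T = A -> B^T = B -> complex.Im z != 0 ->
  resolvent A z - resolvent B z = resolvent A z *m cmx (B - A) *m resolvent B z.
Proof.
move=> As Bs z0; have -> : cmx (B - A) = (cmx B - z%:M) - (cmx A - z%:M).
  by rewrite opprB addrA subrK /cmx map_mxB.
by rewrite mulmxBr mulmxBl -mulmxA mulmxV ?shift_unit// mulmx1 mulVmx ?shift_unit// mul1mx.
Qed.

(** Ward identity: the resolvent identity between z and its conjugate. The resolvent at the
    conjugate point is the entrywise conjugate because [A] is real. *)
Lemma Im_resolvent A z i : A^T = A -> 0 < complex.Im z ->
  complex.Im (resolvent A z i i) =
    complex.Im z * \sum_j normc (resolvent A z i j) ^+ 2.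
Proof.
move=> As z0; have zn0 : complex.Im z != 0 by rewrite gt_eqF.
have znJ : complex.Im z^* != 0 by case: z z0 zn0 => a b /=; rewrite oppr_eq0.
have /matrixP/(_ i i) : resolvent A z - resolvent A z^* =
    (z - z^*) *: (resolvent A z *m resolvent A z^*).
  have -> : (z - z^*) *: (resolvent A z *m resolvent A z^*) =
      resolvent A z *m ((cmx A - z^*%:M) - (cmx A - z%:M)) *m resolvent A z^*.
    rewrite (_ : (cmx A - z^*%:M) - (cmx A - z%:M) = (z - z^*)%:M); last first.
      apply/matrixP => k l; rewrite !mxE; case: eqP => _ /=; rewrite ?mulr1n ?mulr0n; ring.
    by rewrite mul_mx_scalar scalemxAl.
  rewrite mulmxBr mulmxBl -mulmxA mulmxV ?shift_unit// mulmx1 mulVmx ?shift_unit//.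
  by rewrite mul1mx.
rewrite -resolvent_conj !mxE.
have -> : \sum_j resolvent A z i j * map_mx conjc (resolvent A z) j i =
   (\sum_j normc (resolvent A z i j) ^+ 2)%:C.
  rewrite rmorph_sum; apply: eq_bigr => j _ /=.
  by rewrite mxE (resolvent_sym z As j i) mulcJ.
move=> /(congr1 (@complex.Im R)); rewrite mulrC ImZ.
case: (resolvent A z i i) => u v; case: (z) => a b /=; rewrite !opprK => H; nra.
Qed.

Section Bounds.
Variables (A : 'M[R]_n) (z : R[i]).
Hypotheses (As : A^T = A) (z0 : 0 < complex.Im z).
Local Notation G := (resolvent A z).
Local Notation y := (complex.Im z)^-1.

Lemma Im_resolvent_ge0 i : 0 <= complex.Im (G i i).
Proof.
by rewrite Im_resolvent// mulr_ge0 ?(ltW z0)// sumr_ge0// => j _; rewrite sqr_ge0.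
Qed.

(** Writing S for the sum, the Ward identity gives eta S = Im G_ii <= |G_ii| <= S^(1/2). *)
Lemma resolvent_row_norm i : \sum_j normc (G i j) ^+ 2 <= y ^+ 2.
Proof.
set S := \sum_j _.
have S0 : 0 <= S by apply: sumr_ge0 => j _; rewrite sqr_ge0.
have H : (complex.Im z * S) ^+ 2 <= S.
  rewrite -Im_resolvent// -real_normK ?num_real//.
  apply: (@le_trans _ _ (normc (G i i) ^+ 2)).
    by rewrite lerXn2r ?nnegrE ?normc_ge0// Im_le_normc.
  by rewrite /S (bigD1 i)//= lerDl sumr_ge0// => j _; rewrite sqr_ge0.
have [->|Sn0] := eqVneq S 0; first by rewrite sqr_ge0.
have Sp : 0 < S by rewrite lt_neqAle eq_sym Sn0.
rewrite exprMn [S ^+ 2]expr2 mulrA -[leRHS]mul1r ler_pM2r// in H.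
by rewrite exprVn -[leRHS]mul1r ler_pdivlMr ?exprn_gt0// mulrC.
Qed.

Lemma normc_resolvent i j : normc (G i j) <= y.
Proof.
rewrite -(@ler_pXn2r _ 2)// ?nnegrE ?normc_ge0 ?invr_ge0 ?(ltW z0)//.
apply: le_trans (resolvent_row_norm i).
by rewrite (bigD1 j)//= lerDl sumr_ge0// => k _; rewrite sqr_ge0.
Qed.

End Bounds.

(** * Effect of one edge on the resolvent *)

Definition edge_mx (i j : 'I_n) : 'M[R]_n := delta_mx i j + delta_mx j i.

Lemma edge_mx_sym i j : (edge_mx i j)^T = edge_mx i j.
Proof. by rewrite /edge_mx linearD/= !trmx_delta addrC. Qed.

Section Flip.
Variables (A B : 'M[R]_n) (z : R[i]) (h : R) (i j : 'I_n).
Hypotheses (As : A^T = A) (z0 : 0 < complex.Im z) (h0 : 0 <= h).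
Hypothesis BA : B - A = h *: edge_mx i j.
Local Notation G := (resolvent A z).
Local Notation G' := (resolvent B z).
Local Notation y := (complex.Im z)^-1.

Let zn0 : complex.Im z != 0. Proof. by rewrite gt_eqF. Qed.

Let Bs : B^T = B.
Proof.
have -> : B = A + h *: edge_mx i j by rewrite -BA addrC subrK.
by rewrite linearD/= linearZ/= edge_mx_sym As.
Qed.

Lemma flip_resolvent a b :
  G a b - G' a b = h%:C * (G a i * G' j b + G a j * G' i b).
Proof.
have /matrixP/(_ a b) := resolvent_sub As Bs zn0.
rewrite BA; have -> : cmx (h *: edge_mx i j) =
  h%:C *: (delta_mx i j + delta_mx j i).
  apply/matrixP => k l; rewrite !mxE rmorphM rmorphD/=.
  by congr (_ * (_ + _)); case: (_ && _).
rewrite -scalemxAr -scalemxAl mulmxDr mulmxDl.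
by rewrite mxE [X in _ + X]mxE => ->; rewrite !mxE -!mulmx_delta_mx !mxE.
Qed.

Lemma normc_flip_resolvent a b : normc (G a b - G' a b) <= h * (2 * y ^+ 2).
Proof.
rewrite flip_resolvent normcZ// ler_wpM2l//.
apply: (le_trans (ler_normcD _ _)); rewrite !normcM.
have -> : 2 * y ^+ 2 = y * y + y * y by ring.
by apply: lerD; apply: ler_pM; rewrite ?normc_ge0 ?normc_resolvent.
Qed.

(** Adding up the entrywise bounds would lose a factor n. The trace difference is a sum over k of
    products of entries from two rows, so ab <= (a^2 + b^2) / 2 reduces it to row norms. *)
Lemma normc_flip_tr : normc (\tr G - \tr G') <= h * (2 * y ^+ 2).
Proof.
rewrite /mxtrace -sumrB.
rewrite (eq_bigr (fun k => h%:C * (G k i * G' j k + G k j * G' i k))) => [|k _]; last first.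
  exact: flip_resolvent.
rewrite -mulr_sumr normcZ// ler_wpM2l//.
apply: (le_trans (ler_normc_sum _)).
apply: (@le_trans _ _ (\sum_k (2^-1 * (normc (G i k) ^+ 2 + normc (G' j k) ^+ 2) +
    2^-1 * (normc (G j k) ^+ 2 + normc (G' i k) ^+ 2)))).
  apply: ler_sum => k _; apply: (le_trans (ler_normcD _ _)).
  rewrite !normcM (resolvent_sym z As k i) (resolvent_sym z As k j).
  apply: lerD; rewrite -subr_ge0.
    have -> : 2^-1 * (normc (G i k) ^+ 2 + normc (G' j k) ^+ 2) - normc (G i k) * normc (G' j k)
      = 2^-1 * (normc (G i k) - normc (G' j k)) ^+ 2 by field.
    by rewrite mulr_ge0 ?sqr_ge0// invr_ge0.
  have -> : 2^-1 * (normc (G j k) ^+ 2 + normc (G' i k) ^+ 2) - normc (G j k) * normc (G' i k)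
      = 2^-1 * (normc (G j k) - normc (G' i k)) ^+ 2 by field.
  by rewrite mulr_ge0 ?sqr_ge0// invr_ge0.
rewrite big_split/= -!mulr_sumr !big_split/=.
have := resolvent_row_norm As z0 i; have := resolvent_row_norm As z0 j.
have := resolvent_row_norm Bs z0 i; have := resolvent_row_norm Bs z0 j.
lra.
Qed.

End Flip.

End Resolvent.

(** * Stability of the self-consistent equation *)

(** Lagrange's identity: the difference of the two sides is a double sum of squares. *)
Lemma weighted_cauchy_schwarz (R : rcfType) (I : finType) (s W X : I -> R) :
  (forall i, 0 <= s i) -> (forall i, 0 < W i) ->
  (\sum_i s i * X i) ^+ 2 <= (\sum_i s i * W i) * (\sum_i s i * (X i ^+ 2 / W i)).
Proof.
move=> s0 W0; rewrite -subr_ge0.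
suff -> : (\sum_i s i * W i) * (\sum_i s i * (X i ^+ 2 / W i)) -
    (\sum_i s i * X i) ^+ 2 =
  \sum_i \sum_j 2^-1 * (s i * s j) * (W i * W j) * (X i / W i - X j / W j) ^+ 2.
  apply: sumr_ge0 => i _; apply: sumr_ge0 => j _.
  by rewrite mulr_ge0 ?sqr_ge0// mulr_ge0 ?mulr_ge0 ?invr_ge0// ltW.
(* The existential hides the body of [F] while the double sums are split and exchanged. *)
have [F FE] : exists F : I -> I -> R, forall i j,
    F i j = s i * W i * (s j * (X j ^+ 2 / W j)).
  by exists (fun i j => s i * W i * (s j * (X j ^+ 2 / W j))).
have E i j : 2^-1 * (s i * s j) * (W i * W j) * (X i / W i - X j / W j) ^+ 2 =
  2^-1 * F i j + 2^-1 * F j i - s i * X i * (s j * X j).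
  by rewrite !FE; have := lt0r_neq0 (W0 i); have := lt0r_neq0 (W0 j) => ? ?; field; apply/andP.
under [RHS]eq_bigr do under eq_bigr do rewrite E.
have S1 : \sum_i \sum_j F i j = (\sum_i s i * W i) * (\sum_i s i * (X i ^+ 2 / W i)).
  by rewrite big_distrlr/=; under eq_bigr do under eq_bigr do rewrite FE.
have S2 : \sum_i \sum_j F j i = (\sum_i s i * W i) * (\sum_i s i * (X i ^+ 2 / W i)).
  by rewrite exchange_big.
under [RHS]eq_bigr do rewrite sumrB big_split/= -!mulr_sumr.
rewrite sumrB big_split/= -!mulr_sumr S1 S2.
rewrite [X in _ = _ - X](_ : _ = (\sum_i s i * X i) ^+ 2).
  by field.
by rewrite expr2 mulr_suml.
Qed.

Section SemicircleRoot.
Variables (R : rcfType) (z m : R[i]).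
Hypotheses (z0 : 0 < complex.Im z) (m0 : 0 <= complex.Im m) (mz : m * (z + m) = -1).
Local Notation eta := (complex.Im z).

Lemma self_energy_root : m = - (z + m)^-1.
Proof.
have zm : z + m != 0 by apply/eqP => E; move/eqP: mz; rewrite E mulr0 eq_sym oppr_eq0 oner_eq0.
by apply: (mulIf zm); rewrite mz mulNr mulVf.
Qed.

Lemma Im_opp_inv (w : R[i]) :
  complex.Im (- w^-1) = normc (- w^-1) ^+ 2 * complex.Im w.
Proof.
by rewrite ImN Im_inv normc_opp normcV exprVn mulNr opprK mulrC.
Qed.

Lemma root_norm : normc m <= eta^-1.
Proof.
rewrite self_energy_root normc_opp; apply: normc_inv_le => //.
by rewrite ImD ger0_norm ?lerDl// addr_ge0// ltW.
Qed.

(** Imaginary parts in m = -1 / (z + m) give Im m = |m|^2 (eta + Im m). With eta Im m <= 1 this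
    becomes a gap of order eta^2 below 1, from which stability follows. *)
Lemma root_sqr_norm : normc m ^+ 2 * (1 + eta ^+ 2) <= 1.
Proof.
have E : complex.Im m = normc m ^+ 2 * (eta + complex.Im m).
  by rewrite {1 2}self_energy_root Im_opp_inv ImD.
have h : complex.Im m * eta <= 1.
  rewrite -(@ler_pdivlMr _ eta)// div1r; apply: le_trans root_norm.
  by apply: le_trans (Im_le_normc m); rewrite ler_norm.
have p : 0 < eta + complex.Im m by rewrite ltr_wpDr.
rewrite -(@ler_pM2r _ (eta + complex.Im m))// mulrAC -E mul1r.
by have := ler_wpM2l (ltW z0) h; lra.
Qed.

End SemicircleRoot.

(** [c0] bounds the weights from below, [K1] is the error constant in the inequality for the
    weighted squares, and [t] is the parameter used to pass from squares to first powers. *)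
Definition stability_const (R : rcfType) (eta B t : R) : R :=
  let y := eta^-1 in
  let c0 := eta / (B + 2 * y) ^+ 2 in
  let K1 := (8 * y ^+ 4 / c0 + 15 * y ^+ 6) / c0 in
  y + 8 * y ^+ 4 * K1 / t.

Section Stability.
Variables (R : rcfType) (n : nat) (s : 'I_n -> 'I_n -> R) (z m : R[i]) (B eps : R).
Variable (g : 'I_n -> R[i]).
Local Notation eta := (complex.Im z).
Local Notation y := (complex.Im z)^-1.
Hypotheses (s0 : forall i j, 0 <= s i j) (ssym : forall i j, s i j = s j i).
Hypotheses (eps0 : 0 <= eps) (eps1 : eps <= eta ^+ 2 / 2).
Hypothesis srow : forall i, `|\sum_j s i j - 1| <= eps.
Hypotheses (z0 : 0 < eta) (z1 : eta <= 1) (zB : normc z <= B).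
Hypotheses (m0 : 0 <= complex.Im m) (mz : m * (z + m) = -1).
Hypotheses (g0 : forall i, 0 <= complex.Im (g i)) (gy : forall i, normc (g i) <= y).

Let v i := \sum_j (s i j)%:C * g j.
Let D i := z * g i + 1 + g i * v i.
(** [gh i] solves the equation exactly once the average [v i] is frozen, and [g i - gh i] is D_i /
    (z + v_i). Its imaginary part is bounded away from 0, while that of [g i] is only known to be
    nonnegative; hence the weights [W] are taken from [gh]. *)
Let gh i := - (z + v i)^-1.
Let x i := gh i - m.
Let e i := \sum_j (s i j)%:C * (g j - gh j).
Let W i := complex.Im (gh i).
Let c0 := eta / (B + 2 * y) ^+ 2.

Let y0 : 0 < y. Proof. by rewrite invr_gt0. Qed.
Let y1 : 1 <= y. Proof. by rewrite invf_ge1. Qed.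
Let etay : eta * y = 1. Proof. by rewrite mulfV// gt_eqF. Qed.
Let B0 : 0 <= B. Proof. exact: le_trans (normc_ge0 z) zB. Qed.

Let srow_le i : \sum_j s i j <= 1 + eps.
Proof. by have := srow i; rewrite ler_norml lerBlDr addrC => /andP[_]; rewrite addrC. Qed.

Let eps2 : eps <= 2^-1.
Proof. by apply: (le_trans eps1); have := z0; have := z1; nra. Qed.

Let srow2 i : \sum_j s i j <= 2.
Proof. by apply: (le_trans (srow_le i)); have := eps2; lra. Qed.

Let wavg (F : 'I_n -> R[i]) (c : R) i : (forall j, normc (F j) <= c) ->
  normc (\sum_j (s i j)%:C * F j) <= 2 * c.
Proof.
move=> Fc; apply: (le_trans (ler_normc_sum _)).
apply: (@le_trans _ _ (\sum_j s i j * c)).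
  by apply: ler_sum => j _; rewrite normcZ// ler_wpM2l.
by rewrite -mulr_suml ler_wpM2r// (le_trans (normc_ge0 (F i))).
Qed.

Let Imv i : 0 <= complex.Im (v i).
Proof. by rewrite Im_sum sumr_ge0// => j _; rewrite ImZ mulr_ge0. Qed.

Let Imzv i : eta <= complex.Im (z + v i).
Proof. by rewrite ImD lerDl. Qed.

Let zv0 i : z + v i != 0.
Proof.
apply/eqP => E; have := Imzv i; rewrite E /= => /(lt_le_trans z0).
by rewrite ltxx.
Qed.

Let inv_zv i : normc (z + v i)^-1 <= y.
Proof. by apply: normc_inv_le => //; apply: le_trans (Imzv i) _; rewrite ler_norm. Qed.

Let ghy i : normc (gh i) <= y.
Proof. by rewrite normc_opp. Qed.

Let g_gh i : normc (g i - gh i) <= y * normc (D i).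
Proof.
have -> : g i - gh i = D i * (z + v i)^-1.
  by apply: (mulIf (zv0 i)); rewrite mulfVK// mulrBl mulNr mulVf// /D; ring.
by rewrite normcM mulrC ler_wpM2r ?normc_ge0.
Qed.

Let WE i : W i = normc (gh i) ^+ 2 * (eta + complex.Im (v i)).
Proof. by rewrite /W Im_opp_inv ImD. Qed.

Let c0_gt0 : 0 < c0.
Proof. by rewrite divr_gt0// exprn_gt0// ltr_wpDl// mulr_gt0. Qed.

Let Wc i : c0 <= W i.
Proof.
have vy : normc (v i) <= 2 * y by exact: wavg.
have zvB : normc (z + v i) <= B + 2 * y.
  by apply: (le_trans (ler_normcD _ _)); exact: lerD.
have zvp : 0 < normc (z + v i).
  rewrite lt_neqAle normc_ge0 andbT eq_sym; apply: contra (zv0 i) => /eqP E.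
  by apply/eqP/eq0_normc.
rewrite WE -ImD normc_opp normcV exprVn mulrC; apply: ler_pM => //; first exact: ltW.
- by rewrite invr_ge0 sqr_ge0.
- rewrite lef_pV2 ?posrE ?exprn_gt0//; last by rewrite (lt_le_trans zvp).
  by rewrite lerXn2r// nnegrE ltW// (lt_le_trans zvp).
Qed.

Let W0 i : 0 < W i. Proof. exact: lt_le_trans (Wc i). Qed.

Let Wy i : W i <= y.
Proof. by apply: le_trans (ghy i); apply: le_trans (Im_le_normc _); exact: ler_norm. Qed.

Let my : normc m <= y. Proof. exact: root_norm. Qed.

Let xy i : normc (x i) <= 2 * y.
Proof. by apply: (le_trans (ler_normcB _ _)); rewrite mulrDl mul1r lerD. Qed.

Let U i := normc (x i) ^+ 2 / W i.

Let U0 i : 0 <= U i. Proof. by rewrite divr_ge0 ?sqr_ge0// ltW. Qed.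

Let Uc i : U i <= 4 * y ^+ 2 / c0.
Proof.
apply: ler_pM; rewrite ?sqr_ge0 ?invr_ge0 ?(ltW (W0 i))//.
- have -> : 4 * y ^+ 2 = (2 * y) ^+ 2 by ring.
  by rewrite lerXn2r// nnegrE ?normc_ge0// mulr_ge0// ltW.
- by rewrite lef_pV2 ?posrE.
Qed.

Let SU i := \sum_j s i j * U j.

Let SU0 i : 0 <= SU i.
Proof. by apply: sumr_ge0 => j _; rewrite mulr_ge0. Qed.

Let SUc i : SU i <= 8 * y ^+ 2 / c0.
Proof.
have c : 0 <= 4 * y ^+ 2 / c0.
  by rewrite divr_ge0 ?(ltW c0_gt0)// mulr_ge0 ?sqr_ge0.
apply: (@le_trans _ _ (\sum_j s i j * (4 * y ^+ 2 / c0))).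
  by apply: ler_sum => j _; rewrite ler_wpM2l.
rewrite -mulr_suml; apply: le_trans (ler_wpM2r c (srow2 i)) _; lra.
Qed.

Let K1 := (8 * y ^+ 4 / c0 + 15 * y ^+ 6) / c0.

(** The difference of -1 / (z + v_i) and -1 / (z + m) is m gh_i (v_i - m). Here v_i - m splits into
    the linear part, the error of replacing [gh] by [g], and the error in the row sum. *)
Let x_step i : x i = m * gh i * (\sum_j (s i j)%:C * x j +
  (e i + m * (\sum_j s i j - 1)%:C)).
Proof.
have -> : \sum_j (s i j)%:C * x j + (e i + m * (\sum_j s i j - 1)%:C) = v i - m.
  rewrite rmorphB rmorph_sum/= mulrBr mulr1 !addrA -big_split/=.
  rewrite mulr_sumr -big_split/=; congr (_ - _); apply: eq_bigr => j _.
  by rewrite /x; ring.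
have zm : z + m != 0 by apply/eqP => E; move/eqP: mz; rewrite E mulr0 eq_sym oppr_eq0 oner_eq0.
rewrite /x {1 2}(self_energy_root mz) /gh.
by field; rewrite zm zv0.
Qed.

(** Let S denote averaging by [s]. Weighted Cauchy-Schwarz bounds (S |x|)^2 by (S W) (S U). Since
    W_i = |gh_i|^2 (eta + Im v_i) and Im v is S W up to [e], the product |gh_i|^2 (S W)_i is at most
    W_i up to an error. Thus |gh_i|, which may be as large as 1 / eta, is absorbed by the weight and
    only |m|^2 remains. *)
Let U_step i : U i <= normc m ^+ 2 * SU i + K1 * (normc (e i) + eps).
Proof.
pose Sx := \sum_j (s i j)%:C * x j; pose r := e i + m * (\sum_j s i j - 1)%:C.
have Sxy : normc Sx <= 4 * y.
  by rewrite (_ : 4 * y = 2 * (2 * y)); [exact: wavg|ring].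
have ey : normc (e i) <= 4 * y.
  rewrite (_ : 4 * y = 2 * (2 * y)); last by ring.
  by apply: wavg => j; apply: (le_trans (ler_normcB _ _)); rewrite mulrDl mul1r lerD.
have rle : normc r <= normc (e i) + y * eps.
  apply: (le_trans (ler_normcD _ _)); rewrite lerD2l normcM normc_real.
  by apply: ler_pM; rewrite ?normc_ge0.
have ry : normc r <= 7 * y.
  by apply: (le_trans rle); have := eps2; have := y0; nra.
(* Here 15 y = 2 * 4 y + 7 y, from expanding (|Sx| + |r|)^2 with |Sx| <= 4 y and |r| <= 7 y. *)
have h1 : normc (x i) ^+ 2 <= normc m ^+ 2 * normc (gh i) ^+ 2 *
   ((\sum_j s i j * normc (x j)) ^+ 2 + 15 * y * normc r).
  rewrite {1}x_step -/Sx -/r !normcM !exprMn ler_wpM2l//; first by apply: mulr_ge0; exact: sqr_ge0.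
  have a : normc (Sx + r) <= normc Sx + normc r by exact: ler_normcD.
  have b : normc Sx <= \sum_j s i j * normc (x j).
    apply: (le_trans (ler_normc_sum _)); apply: ler_sum => j _.
    by rewrite normcZ.
  have a2 : normc (Sx + r) ^+ 2 <= (normc Sx + normc r) ^+ 2.
    by rewrite lerXn2r// nnegrE ?addr_ge0 ?normc_ge0.
  have b2 : normc Sx ^+ 2 <= (\sum_j s i j * normc (x j)) ^+ 2.
    by rewrite lerXn2r// nnegrE ?normc_ge0// (le_trans (normc_ge0 Sx)).
  apply: (le_trans a2); rewrite sqrrD -addrA; apply: lerD => //.
  have := normc_ge0 r; have := normc_ge0 Sx => q1 q2.
  have : normc Sx * normc r <= 4 * y * normc r by rewrite ler_wpM2r.
  have : normc r ^+ 2 <= 7 * y * normc r by rewrite expr2 ler_wpM2r.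
  rewrite mulr2n; lra.
(* Up to the error, the weights satisfy [normc gh ^+ 2 * S W <= W]. *)
have h2 := @weighted_cauchy_schwarz R _ (s i) W (fun j => normc (x j)) (s0 i) W0.
rewrite -/(SU i) in h2.
have h3 : normc (gh i) ^+ 2 * (\sum_j s i j * W j) <= W i + y ^+ 2 * normc (e i).
  have E : v i = e i + \sum_j (s i j)%:C * gh j.
    by rewrite /e -big_split/=; apply: eq_bigr => j _; rewrite -mulrDr subrK.
  have -> : \sum_j s i j * W j = complex.Im (v i) - complex.Im (e i).
    rewrite E ImD addrC addKr Im_sum; apply: eq_bigr => j _; by rewrite ImZ.
  rewrite WE.
  have : normc (gh i) ^+ 2 * - complex.Im (e i) <= y ^+ 2 * normc (e i).
    apply: (@le_trans _ _ (normc (gh i) ^+ 2 * normc (e i))).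
      rewrite ler_wpM2l ?sqr_ge0//; apply: le_trans (Im_le_normc _).
      by rewrite -normrN ler_norm.
    rewrite ler_wpM2r ?normc_ge0// lerXn2r ?nnegrE ?normc_ge0//; exact: ltW.
  have : 0 <= normc (gh i) ^+ 2 * eta by rewrite mulr_ge0 ?sqr_ge0// ltW.
  by lra.
have m1 : normc m ^+ 2 <= 1.
  have := root_sqr_norm z0 m0 mz; have : 0 <= normc m ^+ 2 * eta ^+ 2 by rewrite mulr_ge0 ?sqr_ge0.
  by rewrite mulrDr mulr1; lra.
have gh2 : normc (gh i) ^+ 2 <= y ^+ 2.
  by rewrite lerXn2r ?nnegrE ?normc_ge0//; exact: ltW.
have h4 : normc (x i) ^+ 2 <= normc m ^+ 2 * SU i * W i +
    (8 * y ^+ 4 / c0 * normc (e i) + 15 * y ^+ 3 * normc r).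
  apply: (le_trans h1); rewrite mulrDr addrA; apply: lerD.
    apply: (@le_trans _ _ (normc m ^+ 2 * ((W i + y ^+ 2 * normc (e i)) * SU i))).
      rewrite -mulrA ler_wpM2l ?sqr_ge0//.
      apply: (le_trans (ler_wpM2l (sqr_ge0 _) h2)).
      by rewrite mulrA ler_wpM2r.
    rewrite mulrDl mulrDr; apply: lerD; first by rewrite [W i * _]mulrC mulrA.
    have ye0 : 0 <= y ^+ 2 * normc (e i) by apply: mulr_ge0; [exact: sqr_ge0|exact: normc_ge0].
    rewrite -[leRHS]mul1r; apply: ler_pM => //; [exact: sqr_ge0|exact: mulr_ge0|].
    have -> : 8 * y ^+ 4 / c0 * normc (e i) = y ^+ 2 * normc (e i) * (8 * y ^+ 2 / c0).
      by field; rewrite ?gt_eqF.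
    by rewrite ler_wpM2l.
  have -> : 15 * y ^+ 3 * normc r = 1 * y ^+ 2 * (15 * y * normc r) by ring.
  rewrite ler_wpM2r ?mulr_ge0 ?normc_ge0 ?(ltW y0)//.
  by apply: ler_pM; rewrite ?sqr_ge0.
have k0 : 0 <= 8 * y ^+ 4 / c0 + 15 * y ^+ 6.
  have y4 : 0 <= y ^+ 4 by rewrite exprn_ge0// ltW.
  have y6 : 0 <= y ^+ 6 by rewrite exprn_ge0// ltW.
  by apply: addr_ge0; [apply: divr_ge0; [exact: mulr_ge0|exact: ltW]|exact: mulr_ge0].
have h5 : 8 * y ^+ 4 / c0 * normc (e i) + 15 * y ^+ 3 * normc r <=
  (8 * y ^+ 4 / c0 + 15 * y ^+ 6) * (normc (e i) + eps).
  have p3 : y ^+ 3 <= y ^+ 6 by rewrite ler_weXn2l.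
  have p4 : y ^+ 4 <= y ^+ 6 by rewrite ler_weXn2l.
  have y3 : 0 <= y ^+ 3 by rewrite exprn_ge0// ltW.
  have y4 : 0 <= y ^+ 4 / c0 by rewrite divr_ge0 ?(ltW c0_gt0)// exprn_ge0// ltW.
  have e0 := normc_ge0 (e i).
  have a1 := ler_wpM2l y3 rle.
  have a2 := ler_wpM2r e0 p3.
  have a3 := ler_wpM2r eps0 p4.
  have a4 := mulr_ge0 y4 eps0.
  have a5 : y ^+ 3 * (y * eps) = y ^+ 4 * eps by ring.
  by rewrite mulrDr a5 in a1; lra.
rewrite /U ler_pdivrMr// mulrDl (le_trans h4)// lerD2l (le_trans h5)//.
have ee0 : 0 <= normc (e i) + eps by rewrite addr_ge0// normc_ge0.
have -> : K1 * (normc (e i) + eps) * W i =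
  (8 * y ^+ 4 / c0 + 15 * y ^+ 6) * (normc (e i) + eps) * (W i / c0).
  by rewrite /K1; field; rewrite ?gt_eqF.
rewrite -[leLHS]mulr1 ler_wpM2l ?mulr_ge0//.
by rewrite ler_pdivlMr// mul1r.
Qed.

Let K1_ge0 : 0 <= K1.
Proof.
rewrite /K1; have y4 : 0 <= y ^+ 4 by rewrite exprn_ge0// ltW.
have y6 : 0 <= y ^+ 6 by rewrite exprn_ge0// ltW.
apply: divr_ge0; last exact: ltW.
by apply: addr_ge0; [apply: divr_ge0; [exact: mulr_ge0|exact: ltW]|exact: mulr_ge0].
Qed.

Let sum_swap (F : 'I_n -> R) : (forall j, 0 <= F j) ->
  \sum_i \sum_j s i j * F j <= (1 + eps) * \sum_j F j.
Proof.
move=> F0; rewrite exchange_big/= mulr_sumr; apply: ler_sum => j _.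
rewrite -mulr_suml ler_wpM2r//; under eq_bigr do rewrite ssym; exact: srow_le.
Qed.

Let sum_e : \sum_i normc (e i) <= 2 * y * \sum_i normc (D i).
Proof.
apply: (@le_trans _ _ (\sum_i \sum_j s i j * (y * normc (D j)))).
  apply: ler_sum => i _; apply: (le_trans (ler_normc_sum _)).
  by apply: ler_sum => j _; rewrite normcZ// ler_wpM2l.
have F0 j : 0 <= y * normc (D j) by rewrite mulr_ge0 ?normc_ge0 ?(ltW y0).
apply: (le_trans (sum_swap F0)); rewrite -mulr_sumr mulrA ler_wpM2r//.
  by apply: sumr_ge0 => j _; exact: normc_ge0.
by rewrite ler_wpM2r ?(ltW y0)//; have := eps2; lra.
Qed.

(** By symmetry of [s] its column sums are also at most 1 + eps, so summation over i yields a scalar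
    inequality. Its gap 1 - |m|^2 (1 + eps) >= eta^2 / 4 absorbs the sum on the right. *)
Let sum_U : \sum_i U i <= 8 * y ^+ 3 * K1 * (\sum_i normc (D i) + n%:R * eps).
Proof.
set S := \sum_i U i; set E := \sum_i normc (D i).
have S0 : 0 <= S by apply: sumr_ge0.
have E0 : 0 <= E by apply: sumr_ge0 => i _; exact: normc_ge0.
have ne0 : 0 <= n%:R * eps by rewrite mulr_ge0.
have h : S <= normc m ^+ 2 * ((1 + eps) * S) + K1 * (2 * y * E + n%:R * eps).
  apply: (@le_trans _ _ (\sum_i (normc m ^+ 2 * SU i + K1 * (normc (e i) + eps)))).
    exact: ler_sum.
  rewrite big_split/= -!mulr_sumr; apply: lerD; rewrite ler_wpM2l ?sqr_ge0//.
    exact: sum_swap.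
  by rewrite big_split/= sumr_const card_ord -[eps *+ n]mulr_natl lerD2r.
have mm := root_sqr_norm z0 m0 mz.
have m2 := sqr_ge0 (normc m).
have k : normc m ^+ 2 * (1 + eps) <= 1 - eta ^+ 2 / 4.
  have a : normc m ^+ 2 * (1 + eps) <= normc m ^+ 2 * (1 + eta ^+ 2 / 2).
    by rewrite ler_wpM2l// lerD2l.
  have ee : eta ^+ 2 <= 1 by rewrite expr_le1// ltW.
  have e2 := sqr_ge0 eta.
  apply: (le_trans a); rewrite -(@ler_pM2r _ (1 + eta ^+ 2)); last by lra.
  rewrite mulrAC; apply: (@le_trans _ _ (1 * (1 + eta ^+ 2 / 2))).
    by rewrite ler_wpM2r//; lra.
  by nra.
have h' : eta ^+ 2 / 4 * S <= K1 * (2 * y * E + n%:R * eps).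
  by have := ler_wpM2r S0 k; rewrite -mulrA; lra.
have -> : S = 4 * y ^+ 2 * (eta ^+ 2 / 4 * S).
  by rewrite [RHS](_ : _ = (eta * y) ^+ 2 * S) ?etay ?expr1n ?mul1r//; field; rewrite ?gt_eqF.
have y2 : 0 <= 4 * y ^+ 2 by rewrite mulr_ge0 ?sqr_ge0.
apply: (le_trans (ler_wpM2l y2 h')).
have -> : 8 * y ^+ 3 * K1 * (E + n%:R * eps) =
  4 * y ^+ 2 * (K1 * (2 * y * E + 2 * y * (n%:R * eps))) by ring.
rewrite ler_wpM2l// ler_wpM2l// lerD2l.
by rewrite -[leLHS]mul1r ler_wpM2r//; have := y1; lra.
Qed.

Lemma self_consistent_stability (t : R) : 0 < t ->
  \sum_i normc (g i - m) <= n%:R * t +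
    stability_const eta B t *
      (\sum_i normc (z * g i + 1 + g i * \sum_j (s i j)%:C * g j) + n%:R * eps).
Proof.
move=> t0; rewrite -/(\sum_i normc (D i)); set E := \sum_i normc (D i).
have ne0 : 0 <= n%:R * eps by rewrite mulr_ge0.
have h i : normc (g i - m) <= y * normc (D i) + (t + y / t * U i).
  have -> : g i - m = (g i - gh i) + x i by rewrite /x; ring.
  apply: (le_trans (ler_normcD _ _)); apply: lerD; first exact: g_gh.
  (* From weighted squares to first powers: |x| <= t + |x|^2 / t, and |x|^2 = U W <= y U. *)
  have a : normc (x i) <= t + normc (x i) ^+ 2 / t.
    rewrite -(@ler_pM2r _ t)// mulrDl mulfVK ?gt_eqF//; nra.
  apply: (le_trans a); rewrite lerD2l [leRHS]mulrAC ler_pM2r ?invr_gt0//.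
  rewrite /U mulrA ler_pdivlMr// mulrC ler_wpM2r ?sqr_ge0//.
apply: (@le_trans _ _ (\sum_i (y * normc (D i) + (t + y / t * U i)))).
  exact: ler_sum.
rewrite big_split/= big_split/= -!mulr_sumr sumr_const card_ord -/E -[t *+ n]mulr_natl.
have yt : 0 <= y / t by rewrite divr_ge0// ltW.
have := ler_wpM2l yt sum_U; rewrite -/E.
have : 0 <= y * (n%:R * eps) by rewrite mulr_ge0// ltW.
rewrite /stability_const -/c0 -/K1.
have -> : y / t * (8 * y ^+ 3 * K1 * (E + n%:R * eps)) =
  8 * y ^+ 4 * K1 / t * (E + n%:R * eps) by field; rewrite ?gt_eqF.
lra.
Qed.

End Stability.

(** * The root of the semicircle equation and its boundary values *)

(** The two roots have product 1 and inversion exchanges the half planes, so they cannot both lie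
    strictly below the real axis. *)
Lemma semicircle_root_exists (R : rcfType) (z : R[i]) : 0 < complex.Im z ->
  exists2 m : R[i], 0 <= complex.Im m & m * (z + m) = -1.
Proof.
move=> z0; pose w := sqrtc (z ^+ 2 - 4).
have w2 : w ^+ 2 = z ^+ 2 - 4 by exact: sqr_sqrtc.
pose r1 := (w - z) / 2; pose r2 := (- w - z) / 2.
have e1 : r1 * (z + r1) = -1.
  have -> : r1 * (z + r1) = (w ^+ 2 - z ^+ 2) / 4 by rewrite /r1; field.
  by rewrite w2; field.
have e2 : r2 * (z + r2) = -1.
  have -> : r2 * (z + r2) = (w ^+ 2 - z ^+ 2) / 4 by rewrite /r2; field.
  by rewrite w2; field.
have [i1|i1] := leP 0 (complex.Im r1); first by exists r1.
have [i2|i2] := leP 0 (complex.Im r2); first by exists r2.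
have e12 : r1 = r2^-1.
  have h : r1 * r2 = 1.
    have -> : r1 * r2 = (z ^+ 2 - w ^+ 2) / 4 by rewrite /r1 /r2; field.
    by rewrite w2; field.
  have r20 : r2 != 0 by apply/eqP => E; move: i2; rewrite E ltxx.
  by rewrite -[LHS](mulfK r20) h mul1r.
move: i1; rewrite e12 Im_inv ltNge divr_ge0 ?sqr_ge0//.
by rewrite oppr_ge0 ltW.
Qed.

(** Write 2 m + z = p + i q with z = x + i eta, so that (p + i q)^2 = z^2 - 4. The real part gives q
    >= s. If q exceeded s + w, both p^2 and q^2 would exceed |x| eta, contradicting p q = x eta. *)
Lemma Im_semicircle_root (R : rcfType) (x eta : R) (m : R[i]) :
  0 < eta -> 0 <= complex.Im m -> m * ((x +i* eta) + m) = -1 ->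
  `|complex.Im m - Num.sqrt (4 - x ^+ 2) / 2| <= Num.sqrt (eta ^+ 2 + `|x| * eta) / 2.
Proof.
case: m => u v /= eta0 v0 /eqP; rewrite eq_complex/= oppr0 => /andP[/eqP Er /eqP Ei].
set s := Num.sqrt (4 - _); set w := Num.sqrt (_ + _).
pose q := 2 * v + eta; pose p := 2 * u + x.
have q0 : 0 < q by rewrite /q; lra.
have e1 : q ^+ 2 - p ^+ 2 = 4 - x ^+ 2 + eta ^+ 2 by rewrite /q /p; nra.
have e2 : p * q = x * eta by rewrite /q /p; nra.
have s0 : 0 <= s by exact: sqrtr_ge0.
have w0 : 0 <= w by exact: sqrtr_ge0.
have xe : 0 <= `|x| * eta by rewrite mulr_ge0// ltW.
have w2 : w ^+ 2 = eta ^+ 2 + `|x| * eta by rewrite sqr_sqrtr// addr_ge0// sqr_ge0.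
have we : eta <= w.
  rewrite -(@ler_pXn2r _ 2)// ?nnegrE//; last exact: ltW.
  by rewrite w2 lerDl.
have sA : 4 - x ^+ 2 <= s ^+ 2.
  have [h|h] := leP 0 (4 - x ^+ 2); first by rewrite sqr_sqrtr.
  by apply: (le_trans (ltW h)); exact: sqr_ge0.
have sq : s <= q.
  have [h|h] := leP 0 (4 - x ^+ 2).
    rewrite -(@ler_pXn2r _ 2)// ?nnegrE//; last exact: ltW.
    rewrite sqr_sqrtr//; have := sqr_ge0 p; have := sqr_ge0 eta; lra.
  by rewrite /s ler0_sqrtr ?ltW.
have qsw : q <= s + w.
  rewrite leNgt; apply/negP => h.
  have h1 : (s + w) ^+ 2 < q ^+ 2.
    by rewrite ltr_pXn2r ?nnegrE ?(ltW q0)// addr_ge0.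
  have h2 : s ^+ 2 + w ^+ 2 < q ^+ 2.
    apply: le_lt_trans h1; rewrite sqrrD addrAC lerDl mulrn_wge0// mulr_ge0//.
  have h3 : `|x| * eta < p ^+ 2 by lra.
  have h4 : `|x| * eta < q ^+ 2.
    have := sqr_ge0 s; have := sqr_ge0 eta; lra.
  have : (`|x| * eta) * (`|x| * eta) < p ^+ 2 * q ^+ 2 by exact: ltr_pM.
  rewrite -exprMn e2 [(x * eta) ^+ 2]exprMn -(real_normK (num_real x)).
  by rewrite -expr2 exprMn ltxx.
have -> : v = (q - eta) / 2 by rewrite /q; field.
by rewrite ler_norml; apply/andP; split; lra.
Qed.

(** * The self-consistent equation in expectation *)

Section Configurations.
Variables (R : rcfType) (n : nat).
Local Notation edges := ('I_n * 'I_n)%type.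
Implicit Types (g : {ffun edges -> bool}) (e : edges).

(* Only the coordinates [(i, j)] with [i < j] of a configuration are read. *)
Definition config_mx g : 'M[R]_n := \matrix_(i, j)
  (if (i < j)%N then g (i, j) else if (j < i)%N then g (j, i) else false)%:R.

(** Ordered pairs that encode no edge get probability 0, so they contribute nothing to the sum of
    probabilities in the moment bounds. *)
Definition edge_prob (p : 'I_n -> 'I_n -> R) e : R :=
  if (e.1 < e.2)%N then p e.1 e.2 else 0.

Definition edge_of (i j : 'I_n) : edges := if (i < j)%N then (i, j) else (j, i).

Lemma config_mx_sym g : (config_mx g)^T = config_mx g.
Proof. by apply/matrixP => i j; rewrite !mxE; case: ltngtP. Qed.

Lemma config_mxE g i j : i != j -> config_mx g i j = (g (edge_of i j))%:R.
Proof.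
move=> ij; rewrite mxE /edge_of; case: ltngtP => // /val_inj E.
by rewrite E eqxx in ij.
Qed.

Lemma config_mx_diag g i : config_mx g i i = 0.
Proof. by rewrite mxE ltnn. Qed.

Lemma edge_probE p i j : (forall i j, p i j = p j i) -> i != j ->
  edge_prob p (edge_of i j) = p i j.
Proof.
move=> psym ij; rewrite /edge_prob /edge_of; case: (ltngtP i j) => [lt|gt|/val_inj E] /=.
- by rewrite lt.
- by rewrite gt psym.
- by rewrite E eqxx in ij.
Qed.

Lemma config_mx_flip g e : (e.1 < e.2)%N ->
  config_mx (set_coord g e true) - config_mx (set_coord g e false) =
  edge_mx R e.1 e.2.
Proof.
case: e => a b /= ab; apply/matrixP => i j; rewrite !mxE !set_coordE !xpair_eqE.
have [ij|ij|/val_inj ij] := ltngtP i j.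
- have -> : (i == b) && (j == a) = false.
    apply/negbTE/negP => /andP[/eqP E1 /eqP E2]; move: ij.
    by rewrite E1 E2 ltnNge ltnW.
  by rewrite addr0; case: (_ && _); rewrite ?subr0// subrr.
- have -> : (i == a) && (j == b) = false.
    apply/negbTE/negP => /andP[/eqP E1 /eqP E2]; move: ij.
    by rewrite E1 E2 ltnNge ltnW.
  by rewrite add0r andbC; case: (_ && _); rewrite ?subr0// subrr.
- have E : (j == a) && (j == b) = false.
    by apply/negbTE/negP => /andP[/eqP E1 /eqP E2]; rewrite -E1 -E2 ltnn in ab.
  by rewrite subrr ij [(j == b) && _]andbC E addr0.
Qed.

Lemma config_mx_nonedge g e b : ~~ (e.1 < e.2)%N ->
  config_mx (set_coord g e b) = config_mx g.
Proof.
case: e => a c /= ac; apply/matrixP => i j; rewrite !mxE !set_coordE !xpair_eqE.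
by case: (ltngtP i j) => // ij; case: ifP => // /andP[/eqP E1 /eqP E2];
  rewrite -E1 -E2 ij in ac.
Qed.

Lemma edge_of_lt i j : i != j -> ((edge_of i j).1 < (edge_of i j).2)%N.
Proof.
by rewrite /edge_of; case: (ltngtP i j) => // /val_inj E; rewrite E eqxx.
Qed.

Lemma edge_mx_edge_of i j : edge_mx R (edge_of i j).1 (edge_of i j).2 = edge_mx R i j.
Proof. by rewrite /edge_of; case: ifP => //= _; rewrite /edge_mx addrC. Qed.

Lemma edge_prob01 p e : (forall i j, 0 <= p i j <= 1) -> 0 <= edge_prob p e <= 1.
Proof. by move=> p01; rewrite /edge_prob; case: ifP => // _; rewrite lexx ler01. Qed.

End Configurations.

(* The expansion of [X1 a1] around the configuration without the edge cancels
   the drift term up to second order in [h]. *)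
Lemma flip_expansion_bound (R : rcfType) (X1 X0 a1 a0 b1 b0 c1 c0 : R[i])
    (h p y k L : R) : 0 <= h <= 1 -> 0 <= p <= 1 -> 0 <= y -> 0 <= L ->
  a0 - a1 = h%:C * (a0 * a1 + c0 * b1) ->
  normc a1 <= y -> normc b1 <= y -> normc c0 <= y ->
  normc X1 <= k -> normc X0 <= k -> normc (X0 - X1) <= h * L ->
  normc (b0 - b1) <= h * (2 * y ^+ 2) -> normc (c1 - c0) <= h * (2 * y ^+ 2) ->
  normc (X1 * a1 + h%:C * (p%:C * (X1 * b1 * c1) + (1 - p)%:C * (X0 * b0 * c0))) <=
  k * (1 + y) * normc a0 + h ^+ 2 * (4 * k * y ^+ 3 + L * y ^+ 2).
Proof.
move=> /andP[h0 h1] /andP[p0 p1] y0 L0 aE a1y b1y c0y X1k X0k X01 b01 c01.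
have k0 : 0 <= k := le_trans (normc_ge0 _) X1k.
have hy0 : 0 <= h * (2 * y ^+ 2) by rewrite mulr_ge0// mulr_ge0// sqr_ge0.
have -> : X1 * a1 + h%:C * (p%:C * (X1 * b1 * c1) + (1 - p)%:C * (X0 * b0 * c0)) =
  X1 * a0 - h%:C * (X1 * a0 * a1) +
  h%:C * (p%:C * (X1 * b1 * (c1 - c0)) +
          (1 - p)%:C * ((X0 * (b0 - b1) + (X0 - X1) * b1) * c0)).
  have -> : a1 = a0 - h%:C * (a0 * a1 + c0 * b1) by rewrite -aE; ring.
  rewrite -aE rmorphB; set q := p%:C; set hh := h%:C in aE *.
  have E : hh * (a0 * a1 + c0 * b1) = a0 - a1 by rewrite aE.
  have -> : a0 - (a0 - a1) = a1 by ring.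
  have -> : X1 * a1 = X1 * a0 - X1 * (hh * (a0 * a1 + c0 * b1)) by rewrite E; ring.
  by rewrite (rmorph1 (real_complex R)); ring.
apply: (le_trans (ler_normcD _ _)); apply: lerD.
  apply: (le_trans (ler_normcB _ _)).
  rewrite mulrDr mulr1 mulrDl; apply: lerD.
    by rewrite normcM ler_wpM2r ?normc_ge0.
  rewrite normcZ// !normcM -[leRHS]mul1r; apply: ler_pM => //.
    by apply: mulr_ge0; rewrite ?mulr_ge0 ?normc_ge0.
  by rewrite mulrAC ler_wpM2r ?normc_ge0//; apply: ler_pM; rewrite ?normc_ge0.
rewrite normcZ// [h ^+ 2]expr2 -[h * h * _]mulrA ler_wpM2l//.
apply: (le_trans (ler_normcD _ _)).
have u1 : normc (X1 * b1 * (c1 - c0)) <= k * y * (h * (2 * y ^+ 2)).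
  by rewrite !normcM; apply: ler_pM; rewrite ?mulr_ge0 ?normc_ge0//; apply: ler_pM; rewrite ?normc_ge0.
have u2 : normc ((X0 * (b0 - b1) + (X0 - X1) * b1) * c0) <=
    (k * (h * (2 * y ^+ 2)) + h * L * y) * y.
  rewrite normcM; apply: ler_pM; rewrite ?normc_ge0//.
  apply: (le_trans (ler_normcD _ _)); rewrite !normcM.
  by apply: lerD; apply: ler_pM; rewrite ?normc_ge0.
rewrite !normcZ ?subr_ge0//.
have v1 : p * normc (X1 * b1 * (c1 - c0)) <= k * y * (h * (2 * y ^+ 2)).
  by rewrite -[leRHS]mul1r; apply: ler_pM => //; exact: normc_ge0.
have v2 : (1 - p) * normc ((X0 * (b0 - b1) + (X0 - X1) * b1) * c0) <=
    (k * (h * (2 * y ^+ 2)) + h * L * y) * y.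
  rewrite -[leRHS]mul1r; apply: ler_pM => //; rewrite ?subr_ge0 ?normc_ge0//.
  by rewrite lerBlDr lerDl.
apply: le_trans (lerD v1 v2) _.
by rewrite le_eqVlt; apply/orP; left; apply/eqP; ring.
Qed.

(** [k] bounds the defect and h [L] its change under a flip. The three summands come from the
    surviving off-diagonal entries |G_ji|, from the second-order terms of the expansion, and from
    the diagonal. *)
Definition defect_const (R : rcfType) (B y : R) : R :=
  let k := B * y + 1 + 2 * y ^+ 2 in
  let L := 2 * B * y ^+ 2 + 8 * y ^+ 3 in
  2 * k * (1 + y) * (1 + y ^+ 2) + 2 * (4 * k * y ^+ 3 + L * y ^+ 2) + k * y ^+ 2.

Section SelfConsistentEquation.
Variables (R : rcfType) (n : nat) (p : 'I_n -> 'I_n -> R) (z : R[i]) (B h r : R).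
Local Notation eta := (complex.Im z).
Local Notation y := (complex.Im z)^-1.
Local Notation edges := ('I_n * 'I_n)%type.
Hypotheses (p0 : forall i j, 0 <= p i j) (psym : forall i j, p i j = p j i).
Hypotheses (r0 : 0 <= r) (r2 : r ^+ 2 <= 2^-1) (pr : forall i j, p i j <= r ^+ 2).
Hypotheses (h0 : 0 < h) (h1 : h <= 1) (prow : forall i, h ^+ 2 * \sum_j p i j <= 2).
Hypotheses (z0 : 0 < eta) (z1 : eta <= 1) (zB : normc z <= B).

Local Notation E := (expect (edge_prob p)).
Local Notation G g := (resolvent (h *: config_mx R g) z).
Implicit Types (g : {ffun edges -> bool}).

Let y0 : 0 < y. Proof. by rewrite invr_gt0. Qed.
Let zn0 : eta != 0. Proof. by rewrite gt_eqF. Qed.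
Let B0 : 0 <= B. Proof. exact: le_trans (normc_ge0 z) zB. Qed.
Let k := B * y + 1 + 2 * y ^+ 2.
Let L := 2 * B * y ^+ 2 + 8 * y ^+ 3.
Let K2 := 4 * k * y ^+ 3 + L * y ^+ 2.

Let p01 i j : 0 <= p i j <= 1.
Proof. by rewrite p0/=; apply: (le_trans (pr i j)); apply: (le_trans r2); lra. Qed.

Let q01 e : 0 <= edge_prob p e <= 1. Proof. exact: edge_prob01. Qed.

Lemma scaled_config_sym g : (h *: config_mx R g)^T = h *: config_mx R g.
Proof. by rewrite linearZ/= config_mx_sym. Qed.
Let Hs := scaled_config_sym.

Definition drift g i := \sum_j (h ^+ 2 * p i j)%:C * G g j j.

Definition defect g i : R[i] := z * G g i i + 1 + G g i i * drift g i.

Let s0 i j : 0 <= h ^+ 2 * p i j. Proof. by rewrite mulr_ge0 ?sqr_ge0. Qed.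

Let drift_sum i (F : 'I_n -> R[i]) c : 0 <= c -> (forall j, normc (F j) <= c) ->
  normc (\sum_j (h ^+ 2 * p i j)%:C * F j) <= 2 * c.
Proof.
move=> c0 Fc; apply: (le_trans (ler_normc_sum _)).
apply: (@le_trans _ _ (\sum_j h ^+ 2 * p i j * c)).
  by apply: ler_sum => j _; rewrite normcZ// ler_wpM2l.
by rewrite -mulr_suml -mulr_sumr ler_wpM2r.
Qed.

Let Gy g i j : normc (G g i j) <= y. Proof. exact: normc_resolvent. Qed.

Let drift_le g i : normc (drift g i) <= 2 * y.
Proof. by apply: drift_sum => //; exact: ltW. Qed.

Let defect_le g i : normc (defect g i) <= k.
Proof.
apply: (le_trans (ler_normcD _ _)); apply: lerD.
  apply: (le_trans (ler_normcD _ _)); rewrite normcM normc1 lerD2r.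
  by apply: ler_pM; rewrite ?normc_ge0.
rewrite normcM (_ : 2 * y ^+ 2 = y * (2 * y)); last by ring.
by apply: ler_pM; rewrite ?normc_ge0.
Qed.

Let flip_mx g i j : i != j ->
  h *: config_mx R (set_coord g (edge_of i j) true) -
  h *: config_mx R (set_coord g (edge_of i j) false) = h *: edge_mx R i j.
Proof.
by move=> ij; rewrite -scalerBr config_mx_flip ?edge_of_lt// edge_mx_edge_of.
Qed.

Let G_flip g i j a b : i != j ->
  normc (G (set_coord g (edge_of i j) false) a b -
         G (set_coord g (edge_of i j) true) a b) <= h * (2 * y ^+ 2).
Proof. by move=> ij; apply: (normc_flip_resolvent (Hs _) z0 (ltW h0) (flip_mx g ij)). Qed.

Let defect_flip g i j : i != j ->
  normc (defect (set_coord g (edge_of i j) false) i -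
         defect (set_coord g (edge_of i j) true) i) <= h * L.
Proof.
move=> ij; have Gf a b := G_flip g a b ij.
move: (set_coord g _ false) (set_coord g _ true) Gf => g0 g1 Gf.
have -> : defect g0 i - defect g1 i = z * (G g0 i i - G g1 i i) +
   ((G g0 i i - G g1 i i) * drift g0 i + G g1 i i * (drift g0 i - drift g1 i)).
  rewrite /defect; move: (G g0 i i) (G g1 i i) (drift g0 i) (drift g1 i) => *; ring.
have hy : 0 <= h * (2 * y ^+ 2) by rewrite mulr_ge0 ?(ltW h0)// mulr_ge0 ?sqr_ge0.
have dd : normc (drift g0 i - drift g1 i) <= 2 * (h * (2 * y ^+ 2)).
  rewrite /drift -sumrB; under eq_bigr do rewrite -mulrBr.
  by apply: drift_sum => // l; exact: Gf.
have -> : h * L = B * (h * (2 * y ^+ 2)) +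
  (h * (2 * y ^+ 2) * (2 * y) + y * (2 * (h * (2 * y ^+ 2)))) by rewrite /L; ring.
apply: (le_trans (ler_normcD _ _)); apply: lerD.
  by rewrite normcM; apply: ler_pM; rewrite ?normc_ge0// Gf.
apply: (le_trans (ler_normcD _ _)); rewrite !normcM.
by apply: lerD; apply: ler_pM; rewrite ?normc_ge0// ?Gf.
Qed.

(** The summands of |D_i|^2 = conj(D_i) D_i after (H G)_ii is written for z G_ii + 1; the j-th one
    is to be averaged over the edge ij alone. *)
Let F i j g : R := complex.Re ((defect g i)^* *
  ((h * config_mx R g i j)%:C * G g j i + (h ^+ 2 * p i j)%:C * (G g i i * G g j j))).

Let defect_sqr g i : normc (defect g i) ^+ 2 = \sum_j F i j g.
Proof.
rewrite -Re_sum -mulr_sumr big_split/=.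
have -> : \sum_j (h * config_mx R g i j)%:C * G g j i = z * G g i i + 1.
  by rewrite (resolvent_row (Hs g) zn0); apply: eq_bigr => j _; rewrite [in RHS]mxE.
have -> : \sum_j (h ^+ 2 * p i j)%:C * (G g i i * G g j j) = G g i i * drift g i.
  by rewrite /drift mulr_sumr; apply: eq_bigr => j _; rewrite mulrCA.
by rewrite mulrC mulcJ.
Qed.

Let K20 : 0 <= K2.
Proof.
have y3 : 0 <= y ^+ 3 by rewrite exprn_ge0// ltW.
have y2 := sqr_ge0 y.
have kk : 0 <= k by rewrite /k; have := mulr_ge0 B0 (ltW y0); lra.
have LL : 0 <= L by rewrite /L; have := mulr_ge0 B0 y2; lra.
by rewrite /K2; have := mulr_ge0 kk y3; have := mulr_ge0 LL y2; lra.
Qed.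

Let k0 : 0 <= k.
Proof. by rewrite /k; have := mulr_ge0 B0 (ltW y0); have := sqr_ge0 y; lra. Qed.

Let resample_F i j g : i != j ->
  resample (edge_prob p) (edge_of i j) (F i j) g <=
  h * p i j * (2 * k * (1 + y)) *
    resample (edge_prob p) (edge_of i j) (fun g => normc (G g j i)) g +
  h ^+ 3 * p i j * K2.
Proof.
move=> ij; rewrite /resample edge_probE//.
set g1 := set_coord g _ true; set g0 := set_coord g _ false.
have A1 : config_mx R g1 i j = 1 by rewrite config_mxE// set_coordE eqxx.
have A0 : config_mx R g0 i j = 0 by rewrite config_mxE// set_coordE eqxx.
have /andP[pp0 pp1] := p01 i j.
have Gf a b : normc (G g0 a b - G g1 a b) <= _ := G_flip g a b ij.
have Gr := flip_resolvent (Hs _) z0 (flip_mx g ij) j i.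
have df := defect_flip g ij.
rewrite -/g0 -/g1 in Gr df.
move: g1 g0 A1 A0 Gf Gr df => g1 g0 A1 A0 Gf Gr df.
have -> : p i j * F i j g1 + (1 - p i j) * F i j g0 =
  complex.Re ((h * p i j)%:C * ((defect g1 i)^* * G g1 j i +
     h%:C * ((p i j)%:C * ((defect g1 i)^* * G g1 i i * G g1 j j) +
             (1 - p i j)%:C * ((defect g0 i)^* * G g0 i i * G g0 j j)))).
  rewrite /F A1 A0 mulr0 mulr1 -!ReZ -ReD; congr complex.Re.
  move: (G g1 i i) (G g1 j j) (G g1 j i) (G g0 i i) (G g0 j j) (G g0 j i) => *.
  move: (defect g0 i)^* (defect g1 i)^* => *.
  rewrite !rmorphM/= !rmorphB/= (rmorph0 (real_complex R)) (rmorph1 (real_complex R)).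
  rewrite ?rmorphXn/=.
  ring.
rewrite ReZ.
set T := (X in complex.Re X).
have Tn : normc T <= k * (1 + y) * normc (G g0 j i) + h ^+ 2 * K2.
  apply: flip_expansion_bound => //.
  - by rewrite (ltW h0).
  - exact: ltW.
  - by rewrite /L; have := mulr_ge0 B0 (sqr_ge0 y); have := exprn_ge0 3 (ltW y0); lra.
  - by rewrite normcJ.
  - by rewrite normcJ.
  - by rewrite -rmorphB normcJ.
  - by rewrite normc_distC; exact: Gf.
have hp0 : 0 <= h * p i j by rewrite mulr_ge0// ltW.
apply: (@le_trans _ _ (h * p i j * (k * (1 + y) * normc (G g0 j i) + h ^+ 2 * K2))).
  rewrite ler_wpM2l//; apply: le_trans Tn.
  by apply: le_trans (Re_le_normc T); exact: ler_norm.
rewrite mulrDr; apply: lerD; last first.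
  by rewrite le_eqVlt; apply/orP; left; apply/eqP; ring.
rewrite -[leRHS]mulrA ler_wpM2l//.
(* Since 1 - p_ij >= 1/2, twice the average over the edge dominates the value without the edge. This
   returns the bound to the original law. *)
have -> : k * (1 + y) * normc (G g0 j i) = (2 * k * (1 + y)) * (2^-1 * normc (G g0 j i)) by field.
have ky : 0 <= 2 * k * (1 + y).
  by rewrite mulr_ge0 ?mulr_ge0// addr_ge0// ltW.
rewrite ler_wpM2l//.
apply: (@le_trans _ _ ((1 - p i j) * normc (G g0 j i))).
  rewrite ler_wpM2r ?normc_ge0//; have := le_trans (pr i j) r2; lra.
by rewrite lerDr mulr_ge0 ?normc_ge0.
Qed.

Let expect_F i j : i != j -> E (F i j) <=
  h * p i j * (2 * k * (1 + y)) * E (fun g => normc (G g j i)) + h ^+ 3 * p i j * K2.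
Proof.
move=> ij; rewrite -(expect_resample _ (edge_of i j) (F i j)).
rewrite -(expect_resample _ (edge_of i j) (fun g => normc (G g j i))).
rewrite -expectZ -[X in _ <= _ + X](expect_cst (edge_prob p)) -expectD.
by apply: ler_expect => // g; exact: resample_F.
Qed.

Let F_diag i g : F i i g <= k * y ^+ 2 * h.
Proof.
rewrite /F config_mx_diag mulr0 (rmorph0 (real_complex R)) mul0r add0r.
apply: (le_trans (ler_norm _)); apply: (le_trans (Re_le_normc _)).
rewrite normcM normcJ -mulrA; apply: ler_pM; rewrite ?normc_ge0//.
rewrite normcZ// mulrC; apply: ler_pM; rewrite ?normc_ge0//.
  by rewrite normcM expr2; apply: ler_pM; rewrite ?normc_ge0.
have /andP[a b] := p01 i i.
by rewrite expr2 -mulrA ler_piMr ?(ltW h0)// mulr_ile1// ltW.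
Qed.

(** In h p |G| = p^(1/2) (h p^(1/2)) |G| the first factor is at most [r], which is the source of
    smallness. For the rest, ab <= (a^2 + b^2) / 2 leaves a row sum of the variances and a row norm
    of the resolvent. *)
Let row_sum g i : \sum_j h * p i j * normc (G g j i) <= r * (1 + y ^+ 2).
Proof.
apply: (@le_trans _ _ (\sum_j 2^-1 * r * (h ^+ 2 * p i j + normc (G g i j) ^+ 2))).
  apply: ler_sum => j _; rewrite (resolvent_sym z (Hs g) j i).
  set a := normc _; have a0 : 0 <= a by exact: normc_ge0.
  set s := Num.sqrt (p i j); have s0' : 0 <= s by exact: sqrtr_ge0.
  have s2 : p i j = s ^+ 2 by rewrite sqr_sqrtr.
  have sr : s <= r by rewrite -(@ler_pXn2r _ 2)// ?nnegrE// -s2.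
  rewrite s2; apply: (@le_trans _ _ (r * (h * s * a))).
    have -> : h * s ^+ 2 * a = s * (h * s * a) by ring.
    by rewrite ler_wpM2r// !mulr_ge0// ltW.
  have -> : 2^-1 * r * (h ^+ 2 * s ^+ 2 + a ^+ 2) = r * (2^-1 * (h ^+ 2 * s ^+ 2 + a ^+ 2)) by ring.
  rewrite ler_wpM2l// -subr_ge0.
  have -> : 2^-1 * (h ^+ 2 * s ^+ 2 + a ^+ 2) - h * s * a = 2^-1 * (h * s - a) ^+ 2 by field.
  by rewrite mulr_ge0 ?sqr_ge0// invr_ge0.
rewrite -mulr_sumr big_split/= -mulr_sumr mulrAC [leRHS]mulrC ler_wpM2r//.
have := prow i; have := resolvent_row_norm (Hs g) z0 i; have := sqr_ge0 y; lra.
Qed.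

Lemma expect_defect_sqr i :
  E (fun g => normc (defect g i) ^+ 2) <= defect_const B y * (r + h).
Proof.
rewrite (eq_expect _ (fun g => defect_sqr g i)) expect_sum (bigD1 i)//=.
have y2 := sqr_ge0 y.
have dg : E (F i i) <= k * y ^+ 2 * h.
  rewrite -[leRHS](expect_cst (edge_prob p)); apply: ler_expect => // g; exact: F_diag.
have ky : 0 <= 2 * k * (1 + y).
  by rewrite mulr_ge0 ?mulr_ge0// addr_ge0// ltW.
have od : \sum_(j | j != i) E (F i j) <= 2 * k * (1 + y) * (r * (1 + y ^+ 2)) + 2 * h * K2.
  apply: (@le_trans _ _ (\sum_j (2 * k * (1 + y) * E (fun g => h * p i j * normc (G g j i)) +
      h * (h ^+ 2 * p i j) * K2))).
    rewrite [leRHS](bigD1 i)//= -[leLHS]add0r; apply: lerD.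
      apply: addr_ge0; last by rewrite mulr_ge0// mulr_ge0// ltW.
      apply: mulr_ge0 => //; rewrite -[leLHS](expect_cst (edge_prob p)).
      apply: ler_expect => // g; rewrite mulr_ge0 ?normc_ge0// mulr_ge0//; exact: ltW.
    apply: ler_sum => j ji; apply: le_trans (expect_F _) _; first by rewrite eq_sym.
    by rewrite expectZ le_eqVlt; apply/orP; left; apply/eqP; ring.
  rewrite big_split/= -mulr_sumr; apply: lerD.
    rewrite ler_wpM2l// -expect_sum -[leRHS](expect_cst (edge_prob p)).
    by apply: ler_expect => // g; exact: row_sum.
  rewrite -mulr_suml -mulr_sumr ler_wpM2r// mulrC ler_wpM2r ?(ltW h0)//.
  by rewrite -mulr_sumr.
apply: le_trans (lerD dg od) _; rewrite /defect_const -/k -/L -/K2.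
have c1 : 0 <= 2 * k * (1 + y) * (1 + y ^+ 2) by rewrite mulr_ge0// addr_ge0.
have c2 : 0 <= k * y ^+ 2 by rewrite mulr_ge0.
have := mulr_ge0 c1 (ltW h0); have := mulr_ge0 c2 r0; have := mulr_ge0 K20 r0.
lra.
Qed.

Let Dc0 : 0 <= defect_const B y.
Proof.
rewrite /defect_const -/k -/L -/K2.
have ky : 0 <= 2 * k * (1 + y).
  by rewrite mulr_ge0 ?mulr_ge0// addr_ge0// ltW.
have := sqr_ge0 y => y2.
have a1 : 0 <= 2 * k * (1 + y) * (1 + y ^+ 2) by rewrite mulr_ge0// addr_ge0.
by rewrite addr_ge0 ?(mulr_ge0 k0 y2)// addr_ge0 ?(mulr_ge0 _ K20).
Qed.

(** Young's inequality with a free [t] replaces the square root of the second moment. *)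
Lemma expect_defect i t : 0 < t ->
  E (fun g => normc (defect g i)) <= t + defect_const B y * (r + h) / t.
Proof.
move=> t0; apply: (@le_trans _ _ (E (fun g => t + t^-1 * normc (defect g i) ^+ 2))).
  apply: ler_expect => // g; set d := normc _.
  rewrite -(@ler_pM2r _ t)// mulrDl mulrAC mulVf ?gt_eqF// mul1r; nra.
rewrite expectD expect_cst lerD2l expectZ mulrC ler_pM2r ?invr_gt0//.
exact: expect_defect_sqr.
Qed.

(** Stability is deterministic and holds for every configuration, so it is averaged afterwards; only
    the defects are estimated in expectation. *)
Lemma expect_stieltjes (m : R[i]) (eps t t' : R) :
  0 <= complex.Im m -> m * (z + m) = -1 -> 0 <= eps -> eps <= eta ^+ 2 / 2 ->
  (forall i, `|\sum_j h ^+ 2 * p i j - 1| <= eps) -> 0 < t -> 0 < t' -> (0 < n)%N ->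
  `|E (fun g => n%:R^-1 * complex.Im (\tr (G g))) - complex.Im m| <=
  t + stability_const eta B t * (t' + defect_const B y * (r + h) / t' + eps).
Proof.
move=> m0 mz e0 e1 srow t0 t'0 n0.
have nr0 : 0 < n%:R :> R by rewrite ltr0n.
have St0 : 0 <= stability_const eta B t.
  have y6 : 0 <= y ^+ 6 by rewrite exprn_ge0// ltW.
  have y4 : 0 <= y ^+ 4 by rewrite exprn_ge0// ltW.
  have c0 : 0 <= eta / (B + 2 * y) ^+ 2 by rewrite divr_ge0 ?sqr_ge0 ?(ltW z0).
  rewrite /stability_const; apply: addr_ge0; first exact: ltW.
  apply: divr_ge0; last exact: ltW.
  apply: mulr_ge0; first exact: mulr_ge0.
  apply: divr_ge0 => //; apply: addr_ge0; last exact: mulr_ge0.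
  by apply: divr_ge0 => //; exact: mulr_ge0.
set St := stability_const eta B t in St0 *.
apply: (@le_trans _ _ (E (fun g => n%:R^-1 * \sum_i normc (G g i i - m)))).
  rewrite -[X in _ - X](expect_cst (edge_prob p)) -[X in _ - X]mul1r -mulNr.
  rewrite -expectZ -expectD; apply: (le_trans (ler_norm_expect _ _)) => //.
  apply: ler_expect => // g; rewrite mulN1r.
  have -> : complex.Im m = n%:R^-1 * \sum_(i < n) complex.Im m.
    by rewrite sumr_const card_ord -[complex.Im m *+ n]mulr_natl mulKf// gt_eqF.
  rewrite Im_sum -mulrBr -sumrB normrM ger0_norm ?invr_ge0 ?(ltW nr0)//.
  rewrite ler_wpM2l ?invr_ge0 ?(ltW nr0)//.
  apply: (le_trans (ler_norm_sum _ _ _)); apply: ler_sum => i _.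
  by rewrite -ImN -ImD; exact: Im_le_normc.
apply: (@le_trans _ _ (E (fun g => n%:R^-1 * (n%:R * t +
   St * (\sum_i normc (defect g i) + n%:R * eps))))).
  apply: ler_expect => // g; rewrite ler_wpM2l ?invr_ge0 ?(ltW nr0)//.
  apply: self_consistent_stability => //.
  - by move=> i j; rewrite psym.
  - by move=> i; exact: Im_resolvent_ge0.
rewrite expectZ expectD expect_cst expectZ expectD expect_cst expect_sum.
rewrite ler_pdivrMl// [leRHS]mulrDr lerD2l [leRHS]mulrCA ler_wpM2l// [leRHS]mulrDr lerD2r.
apply: (@le_trans _ _ (\sum_(i < n) (t' + defect_const B y * (r + h) / t'))).
  by apply: ler_sum => i _; exact: expect_defect.
by rewrite sumr_const card_ord mulr_natl.
Qed.

End SelfConsistentEquation.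

(** * Semicircle distribution function and smoothed eigenvalue counts *)

Section SemicircleCdf.
Variable R : realType.
Implicit Types x : R.

(* [Num.sqrt] vanishes on negative numbers, so the indicator is redundant. *)
Lemma semicircle_densityE x :
  semicircle_density x = (2 * pi)^-1 * Num.sqrt (4 - x ^+ 2).
Proof.
rewrite /semicircle_density indicE mem_setE /= in_itv/=.
have [h|h] := boolP (-2 <= x <= 2); rewrite ?mul1r// mul0r ler0_sqrtr ?mulr0//.
rewrite subr_le0 leNgt; apply/negP => x4; move/negP: h; apply.
rewrite -ler_norml -(@ler_pXn2r _ 2)// ?nnegrE// real_normK ?num_real//.
by apply: (le_trans (ltW x4)); lra.
Qed.

Lemma continuous_semicircle_density : continuous (@semicircle_density R).
Proof.
move=> x; rewrite (_ : @semicircle_density R =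
   fun x => (2 * pi)^-1 * Num.sqrt (4 - x ^+ 2)); last first.
  by apply/funext => y; exact: semicircle_densityE.
apply: cvgM; first exact: cvg_cst.
apply: continuous_comp; last exact: sqrt_continuous.
by apply: cvgB; [exact: cvg_cst|exact: exprn_continuous].
Qed.

Lemma semicircle_density_out x : 2 <= `|x| -> semicircle_density x = 0.
Proof.
move=> x2; rewrite semicircle_densityE ler0_sqrtr ?mulr0//.
rewrite subr_le0 -(real_normK (num_real x)).
by have := @lerXn2r R 2 2 `|x| _ _ x2; rewrite !nnegrE; lra.
Qed.

Local Notation mu := (@lebesgue_measure R).

Lemma integrable_semicircle_density : mu.-integrable setT (EFin \o @semicircle_density R).
Proof.
have h : mu.-integrable `[(-2 : R), 2] (EFin \o @semicircle_density R).
  apply: continuous_compact_integrable; first exact: segment_compact.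
  exact/continuous_subspaceT/continuous_semicircle_density.
have : mu.-integrable setT ((EFin \o @semicircle_density R) \_ `[(-2 : R), 2]).
  by rewrite -integrable_mkcond.
apply: eq_integrable => // x _; rewrite patchE; case: ifPn => // xn /=.
rewrite semicircle_density_out//; move: xn.
by rewrite notin_setE/= in_itv/= -ler_norml => /negP; rewrite -ltNge => /ltW.
Qed.

Lemma is_derive_semicircle_cdf x :
  is_derive x 1 (@semicircle_cdf R) (semicircle_density x).
Proof.
have [d e] : derivable (@semicircle_cdf R) x 1 /\ derive1 (@semicircle_cdf R) x = semicircle_density x.
  apply: (@continuous_FTC1 _ _ -oo%O x (x + 1)) => //.
  - by rewrite ltrDl.
  - by apply: integrableS integrable_semicircle_density.
  - by rewrite ltNyr.
  - exact: continuous_semicircle_density.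
by apply: DeriveDef; [exact: d|rewrite -derive1E].
Qed.

Lemma semicircle_cdf_eq0 x : x <= -2 -> semicircle_cdf x = 0.
Proof.
move=> x2; rewrite /semicircle_cdf /semicircle_law.
rewrite (eq_integral (cst 0%E)) ?integral0// => y.
rewrite inE/= in_itv/= => yx; rewrite semicircle_density_out//.
by rewrite -normrN ler_normr; apply/orP; left; lra.
Qed.

End SemicircleCdf.

Lemma is_derive_fsum (R : realType) (I : finType) (h : I -> R -> R) (dh : I -> R) (x : R) :
  (forall i, is_derive x 1 (h i) (dh i)) ->
  is_derive x 1 (fun y => \sum_i h i y) (\sum_i dh i).
Proof.
move=> H; have -> : (fun y => \sum_i h i y) = \sum_i h i.
  by apply/funext => y; rewrite fct_sumE.
elim/big_ind2 : _ => [|f a g b fa gb|//]; last exact: is_deriveD.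
exact: is_derive_cst.
Qed.

(** Stands in for integrating the bound on the derivative over [a, b]. *)
Lemma MVT_bound (R : realType) (f df : R -> R) (a b c : R) : a <= b ->
  (forall x : R, is_derive x 1 f (df x)) ->
  (forall x : R, a <= x <= b -> `|df x| <= c) -> `|f b - f a| <= (b - a) * c.
Proof.
move=> ab fdf dfc.
have cf : {within `[a, b], continuous f}.
  apply: derivable_within_continuous => x _; by have [] := fdf x.
have [x xab ->] := MVT_segment ab (fun x _ => fdf x) cf.
rewrite normrM mulrC (ger0_norm (_ : 0 <= b - a)) ?subr_ge0//.
by rewrite ler_wpM2l ?subr_ge0// dfc.
Qed.

Section ArctanCount.
Variables (R : realType) (n : nat).
Implicit Types (A B : 'M[R]_n) (eta x : R).

(** An antiderivative of n^-1 Im tr G(x + i eta) in x. Its increments are pi times the mass given to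
    an interval by the spectral distribution convolved with a Cauchy law of scale [eta]. *)
Definition arctan_count A eta x : R :=
  n%:R^-1 * \sum_i atan ((x - eigval A i) / eta).

Lemma is_derive_arctan_count A eta x : A^T = A -> 0 < eta ->
  is_derive x 1 (arctan_count A eta)
    (n%:R^-1 * complex.Im (\tr (resolvent A (x +i* eta)))).
Proof.
move=> As e0.
have en0 : eta != 0 by rewrite gt_eqF.
rewrite (tr_resolvent As)// Im_sum.
apply: (@is_deriveZ _ _ _ (fun y => \sum_i atan ((y - eigval A i) / eta)) n%:R^-1).
apply: is_derive_fsum => i; set l := eigval A i.
have -> : complex.Im (l%:C - (x +i* eta))^-1 =
    (1 + ((x - l) / eta) ^+ 2)^-1 * eta^-1.
  rewrite Im_inv sqr_normc ImD ReD ImN ReN/= add0r opprK sqrrN.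
  field; rewrite en0 /= gt_eqF// ltr_wpDr ?sqr_ge0 ?exprn_gt0//.
apply: (@is_derive1_comp _ atan (fun y => (y - l) / eta)).
have -> : (fun y => (y - l) / eta) = eta^-1 *: (id - cst l : R -> R).
  by apply/funext => y; rewrite mulrC.
rewrite -[X in is_derive _ _ _ X]mulr1 -[X in _ * X]subr0.
by apply: is_deriveZ; apply: is_deriveB; exact: is_derive_cst.
Qed.

Lemma arctan_count_flip A B eta a b h (i j : 'I_n) :
  A^T = A -> 0 < eta -> 0 <= h -> a <= b -> B - A = h *: edge_mx R i j ->
  `|(arctan_count B eta b - arctan_count B eta a) -
    (arctan_count A eta b - arctan_count A eta a)| <=
  (b - a) * (n%:R^-1 * (h * (2 * eta^-1 ^+ 2))).
Proof.
move=> As e0 h0 ab BA.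
have Bs : B^T = B.
  have -> : B = A + h *: edge_mx R i j by rewrite -BA addrC subrK.
  by rewrite linearD/= linearZ/= edge_mx_sym As.
pose f x := arctan_count B eta x - arctan_count A eta x.
have -> : arctan_count B eta b - arctan_count B eta a -
    (arctan_count A eta b - arctan_count A eta a) = f b - f a by rewrite /f; ring.
apply: (MVT_bound ab (df := fun x => n%:R^-1 * complex.Im (\tr (resolvent B (x +i* eta)))
   - n%:R^-1 * complex.Im (\tr (resolvent A (x +i* eta))))).
  by move=> x; apply: is_deriveB; exact: is_derive_arctan_count.
move=> x _; rewrite -mulrBr normrM ger0_norm ?invr_ge0// ler_wpM2l ?invr_ge0//.
rewrite -ImN -ImD; apply: (le_trans (Im_le_normc _)); rewrite normc_distC.
exact: (normc_flip_tr As (z := x +i* eta) e0 h0 BA).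
Qed.

End ArctanCount.

Lemma expect_arctan_count (R : realType) (n : nat)
    (q : 'I_n * 'I_n -> R) (h eta a b delta : R) :
  0 < eta -> a <= b ->
  (forall x, a <= x <= b ->
    `|expect q (fun g => n%:R^-1 *
        complex.Im (\tr (resolvent (h *: config_mx R g) (x +i* eta)))) -
      pi * semicircle_density x| <= delta) ->
  `|expect q (fun g => arctan_count (h *: config_mx R g) eta b -
                       arctan_count (h *: config_mx R g) eta a) -
    pi * (semicircle_cdf b - semicircle_cdf a)| <= (b - a) * delta.
Proof.
move=> e0 ab H.
pose f x := expect q (fun g => arctan_count (h *: config_mx R g) eta x) -
  pi * semicircle_cdf x.
have -> : expect q (fun g => arctan_count (h *: config_mx R g) eta b -
    arctan_count (h *: config_mx R g) eta a) - pi * (semicircle_cdf b - semicircle_cdf a) =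
    f b - f a.
  rewrite (eq_expect _ (f2 := fun g => arctan_count (h *: config_mx R g) eta b +
     -1 * arctan_count (h *: config_mx R g) eta a)); last by move=> g; rewrite mulN1r.
  by rewrite expectD (expectZ _ (-1)) /f; ring.
apply: (MVT_bound ab (df := fun x => expect q (fun g => n%:R^-1 *
  complex.Im (\tr (resolvent (h *: config_mx R g) (x +i* eta)))) -
  pi * semicircle_density x)) => // x.
apply: is_deriveB.
  apply: is_derive_fsum => g.
  apply: (@is_deriveZ _ _ _ (arctan_count (h *: config_mx R g) eta)).
  by apply: is_derive_arctan_count => //; exact: scaled_config_sym.
apply: (@is_deriveZ _ _ _ (@semicircle_cdf R)).
exact: is_derive_semicircle_cdf.
Qed.

(** * Concentration and Borel-Cantelli *)

Lemma borel_cantelli_inv_square (d : measure_display) (T : measurableType d)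
    (R : realType) (P : probability T R) (F : nat -> set T) (K : R) :
  (forall n, measurable (F n)) ->
  (\forall n \near \oo, (P (F n) <= (K / n%:R ^+ 2)%:E)%E) ->
  {ae P, forall w, \forall n \near \oo, ~ F n w}.
Proof.
move=> mF [N _ FK].
(* The bound holds only eventually. Emptying the earlier sets leaves the limit superior unchanged
   and makes every partial sum controllable. *)
pose B n := if (N < n)%N then F n else set0.
have mB n : measurable (B n) by rewrite /B; case: ifP.
have K0 : 0 <= K.
  have h := FK N.+1 (leqnSn N).
  have : (0 <= (K / N.+1%:R ^+ 2)%:E)%E by apply: le_trans h; exact: measure_ge0.
  by rewrite lee_fin pmulr_lge0// invr_gt0 exprn_gt0.
(* Telescoping by 1 / x^2 <= 2 / x - 2 / (x + 1) for x >= 1. *)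
have S m : (\sum_(0 <= k < m.+1) P (B k) <= (K * (4 - 2 / m.+1%:R))%:E)%E.
  elim: m => [|m IH].
    by rewrite big_nat1 /B ltn0 measure0 lee_fin divr1 mulr_ge0//; lra.
  rewrite big_nat_recr//=.
  have PB : (P (B m.+1) <= (K / m.+1%:R ^+ 2)%:E)%E.
    rewrite /B; case: ifP => [h|_]; first by apply: FK; exact: ltnW.
    by rewrite measure0 lee_fin divr_ge0// exprn_ge0.
  apply: (le_trans (leeD IH PB)); rewrite -EFinD lee_fin -mulrDr ler_wpM2l//.
  have m0 : 0 < m.+1%:R :> R by rewrite ltr0n.
  have m2 : (m.+2%:R = m.+1%:R + 1 :> R)%R by rewrite -natr1.
  have m1 : 1 <= m.+1%:R :> R by rewrite ler1n.
  rewrite m2; set x := m.+1%:R in m0 m1 *; rewrite -subr_ge0.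
  have -> : 4 - 2 / (x + 1) - (4 - 2 / x + (x ^+ 2)^-1) = (x - 1) / (x ^+ 2 * (x + 1)).
    by field; rewrite !gt_eqF//; lra.
  by rewrite divr_ge0 ?subr_ge0// mulr_ge0 ?sqr_ge0//; lra.
have P0 : P (lim_sup_set B) = 0%E.
  apply: lim_sup_set_cvg0 => //; apply: (@le_lt_trans _ _ (K * 4)%:E); last exact: ltry.
  apply: lime_le; first by apply: is_cvg_nneseries => n _ _; exact: measure_ge0.
  apply: nearW => -[|m]; first by rewrite big_nil lee_fin mulr_ge0.
  apply: (le_trans (S m)); rewrite lee_fin ler_wpM2l// gerBl divr_ge0//.
exists (lim_sup_set B); split => //.
  by apply: bigcap_measurable => // k _; apply: bigcup_measurable => j _; exact: mB.
move=> w /= nw k _; apply: contrapT => H; apply: nw.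
exists (maxn k N.+1) => // n /=; rewrite geq_max => /andP[kn Nn] Fw.
by apply: H; exists n => //=; rewrite /B Nn.
Qed.

(** * The law of a family of independent events as a product Bernoulli measure *)

Section IndependentLaw.
Variables (d : measure_display) (T : measurableType d) (R : realType)
  (P : probability T R) (I : finType) (D : {set I}) (E : I -> set T) (q : I -> R).
Hypotheses (mE : forall i, measurable (E i)) (indE : independent_events P D E).
Hypotheses (Eq : forall i, i \in D -> P (E i) = (q i)%:E).
Hypotheses (q0 : forall i, i \notin D -> q i = 0).

Let cyl (J : {set I}) (s : seq I) : set T :=
  (\bigcap_(i in [set` J]) E i) `&` (\bigcap_(i in [set` s]) ~` E i).

Let mcyl J s : measurable (cyl J s).
Proof.
apply: measurableI.
  by apply: fin_bigcap_measurable; [exact: finite_finset|move=> i _; exact: mE].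
by apply: fin_bigcap_measurable; [exact: finite_seq|move=> i _; exact/measurableC/mE].
Qed.

(** Independence speaks of intersections of the events themselves. Complements are added one at a
    time, splitting a cylinder according to whether the event at [b] occurs. *)
Let P_cyl (s : seq I) : forall J : {set I}, J \subset D -> uniq s ->
  {subset s <= D} -> {in s, forall i, i \notin J} ->
  P (cyl J s) = ((\prod_(i in J) q i) * \prod_(i <- s) (1 - q i))%:E.
Proof.
elim: s => [|b s IH] J JD.
  move=> _ _ _; rewrite big_nil mulr1 /cyl.
  rewrite (_ : \bigcap_(i in [set` [::]]) ~` E i = setT); last first.
    by apply/seteqP; split => // w _ i.
  rewrite setIT indE// (eq_bigr (fun i => (q i)%:E)); last first.
    by move=> i iJ; apply: Eq; exact: (fintype.subsetP JD).
  by elim/big_ind2 : _ => // x x' y y' -> ->; rewrite EFinM.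
move=> /= /andP[bs us] sD sJ.
have bD : b \in D by apply: sD; rewrite mem_head.
have bJ : b \notin J by apply: sJ; rewrite mem_head.
have sD' : {subset s <= D} by move=> i si; apply: sD; rewrite in_cons si orbT.
have sJ' : {in s, forall i, i \notin J} by move=> i si; apply: sJ; rewrite in_cons si orbT.
have e1 := IH J JD us sD' sJ'.

have e2 : P (cyl (b |: J) s) =
    ((\prod_(i in b |: J) q i) * \prod_(i <- s) (1 - q i))%:E.
  apply: IH => //; first by rewrite finset.subUset finset.sub1set bD.
  move=> i si; rewrite !inE negb_or sJ'// andbT.
  by apply: contra bs => /eqP <-.
have split : cyl J s = cyl J (b :: s) `|` cyl (b |: J)%SET s.
  apply/seteqP; split => w.
    move=> [wJ ws]; have [Eb|Eb] := pselect (E b w).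
      right; split => // i /=; rewrite !inE => /orP[/eqP -> //|]; exact: wJ.
    left; split => // i /=; rewrite in_cons => /orP[/eqP -> //|]; exact: ws.
  move=> [[wJ ws]|[wJ ws]].
    by split => // i si; apply: ws; rewrite /= in_cons [_ \in s]si orbT.
  by split => // i iJ; apply: wJ; rewrite /= !inE [_ \in J]iJ orbT.
have disj : cyl J (b :: s) `&` cyl (b |: J)%SET s = set0.
  apply/seteqP; split => // w [[_ wb] [wJ _]]; apply: (wb b) => /=.
    by rewrite mem_head.
  by apply: wJ; rewrite /= !inE eqxx.
have : P (cyl J s) = (P (cyl J (b :: s)) + P (cyl (b |: J) s))%E.
  by rewrite {1}split measureU.
rewrite e1 e2 finset.big_setU1//= big_cons.
have := fin_num_measure P _ (mcyl J (b :: s)); case: (P _) => // x _ [] xE.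
by congr (_%:E); move: xE; set u := \prod_(i in J) _; set v := \prod_(i <- s) _; nra.
Qed.

(** Outside [D] the value false is forced on both sides: by the definition of the configuration, and
    in the weight because [q] vanishes there. *)
Lemma probability_config (g : {ffun I -> bool}) :
  P [set w | [ffun i => (i \in D) && `[< E i w >]] = g] = (config_weight q g)%:E.
Proof.
have [gD|] := pselect (forall i, g i -> i \in D); last first.
  move/existsNP => [i /not_implyP[gi /negP iD]].
  rewrite (_ : [set w | _] = set0); last first.
    apply/seteqP; split => // w /= /ffunP/(_ i); rewrite ffunE gi => /andP[iD' _].
    by rewrite iD' in iD.
  by rewrite measure0 /config_weight (bigD1 i)//= gi q0// mul0r.
pose J := [set i in D | g i]%SET; pose s := enum (D :\: J)%SET.
have -> : [set w | [ffun i => (i \in D) && `[< E i w >]] = g] = cyl J s.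
  apply/seteqP; split => w /=.
    move=> /ffunP wg; split => i /=.
      by rewrite !inE => /andP[_]; rewrite -wg ffunE => /andP[_ /asboolP].
    rewrite mem_enum !inE => /andP[+ iD]; rewrite iD/= -wg ffunE iD/= => h Ei.
    by move/negP: h; apply; exact/asboolP.
  move=> [wJ ws]; apply/ffunP => i; rewrite ffunE.
  have [gi|gi] := boolP (g i).
    rewrite (gD _ gi)/=; apply/asboolP; apply: wJ; by rewrite /= !inE gD.
  have [iD|//] := boolP (i \in D); apply/asboolP; apply: ws.
  by rewrite /= mem_enum !inE iD (negbTE gi).
rewrite P_cyl ?enum_uniq//.
- congr (_%:E); rewrite big_enum/= /config_weight [RHS](bigID (fun i => i \in D))/=.
  rewrite [X in _ = _ * X]big1 ?mulr1; last first.
    move=> i iD; rewrite q0// subr0; case: ifP => // /gD; by rewrite (negbTE iD).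
  rewrite [RHS](bigID (fun i => g i))/=; congr (_ * _).
    rewrite (eq_bigl (fun i => (i \in D) && g i)); last by move=> i; rewrite !inE.
    by apply: eq_bigr => i /andP[_ ->].
  rewrite (eq_bigl (fun i => (i \in D) && ~~ g i)); last first.
    by move=> i; rewrite !inE; case: (i \in D) => //=; rewrite andbT.
  by apply: eq_bigr => i /andP[_ /negbTE ->].
- by apply/fintype.subsetP => i; rewrite inE => /andP[].
- by move=> i; rewrite mem_enum inE => /andP[].
- by move=> i; rewrite mem_enum inE => /andP[].
Qed.

Let config w : {ffun I -> bool} := [ffun i => (i \in D) && `[< E i w >]].

Let config_bigcup (B : pred {ffun I -> bool}) :
  [set w | B (config w)] = \bigcup_(g in [set` B]) [set w | config w = g].
Proof.
apply/seteqP; split => w /=; first by move=> Bw; exists (config w).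
by move=> [g Bg /= ->].
Qed.

Let mconfig g : measurable [set w | config w = g].
Proof.
rewrite (_ : mkset _ = \bigcap_(i in [set: I])
   (if g i then (if i \in D then E i else set0) else (if i \in D then ~` E i else setT))).
  apply: fin_bigcap_measurable; first exact: finite_finset.
  by move=> i _; case: ifP; case: ifP => // _ _; exact: measurableC.
apply/seteqP; split => w /=.
  move=> <- i _; rewrite ffunE; case: (i \in D) => //=.
  by case: ifPn => /asboolP.
move=> H; apply/ffunP => i; rewrite ffunE; have := H i Logic.I.
by case: ifP => gi; case: ifP => iD //= Ei; [apply/asboolP|apply/asboolPn].
Qed.

Lemma measurable_config (B : pred {ffun I -> bool}) : measurable [set w | B (config w)].
Proof.
rewrite config_bigcup; apply: fin_bigcup_measurable => //; exact: finite_finpred.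
Qed.

Lemma probability_config_pred (B : pred {ffun I -> bool}) :
  P [set w | B (config w)] = (\sum_(g | B g) config_weight q g)%:E.
Proof.
rewrite config_bigcup measure_fin_bigcup//.
- rewrite (eq_fsbigr (fun g => (config_weight q g)%:E)); last first.
    by move=> g _; exact: probability_config.
  rewrite fsumEFin//; congr (_%:E).
  by rewrite -(bigfs _ (index_enum_uniq _))// => g _; rewrite mem_index_enum.
- by move=> g g' _ _ [w [/= <- <-]].
Qed.

End IndependentLaw.

Section Concentration.
Variables (R : realType) (d : measure_display) (Omega : measurableType d)
  (P : probability Omega R) (p : forall n : nat, 'I_n -> 'I_n -> R)
  (G : forall n : nat, Omega -> rel 'I_n).
Hypothesis p01 : forall (n : nat) (i j : 'I_n), 0 <= p i j <= 1.
Hypothesis GER : forall n : nat, inhomogeneous_ER P (@p n) (@G n).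

Definition graph_config n (w : Omega) : {ffun 'I_n * 'I_n -> bool} :=
  [ffun e : 'I_n * 'I_n => (e.1 < e.2)%N && G w e.1 e.2].

Let D n := [set e : 'I_n * 'I_n | (e.1 < e.2)%N]%SET.

Let graph_configE n w : graph_config n w =
  [ffun e : 'I_n * 'I_n => (e \in D n) && `[< edge_event (@G n) e w >]].
Proof. by apply/ffunP => e; rewrite !ffunE inE; congr (_ && _); rewrite asboolb. Qed.

Let mG n e : measurable (edge_event (@G n) e).
Proof. by case: e => i j; exact: ER_meas (GER n) i j. Qed.

Let PG n e : e \in D n -> P (edge_event (@G n) e) = (edge_prob (@p n) e)%:E.
Proof.
case: e => i j; rewrite inE /edge_prob /= => ij; rewrite ij.
by move: (ER_prob (GER n) ij).
Qed.

Let q0 n (e : 'I_n * 'I_n) : e \notin D n -> edge_prob (@p n) e = 0.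
Proof. by rewrite inE /edge_prob => /negbTE ->. Qed.

Lemma measurable_graph_config n (B : pred {ffun 'I_n * 'I_n -> bool}) :
  measurable [set w | B (graph_config n w)].
Proof.
under eq_set do rewrite graph_configE.
exact: (measurable_config _ (@mG n)).
Qed.

Lemma probability_graph_config n (B : pred {ffun 'I_n * 'I_n -> bool}) :
  P [set w | B (graph_config n w)] =
  (\sum_(g | B g) config_weight (edge_prob (@p n)) g)%:E.
Proof.
under eq_set do rewrite graph_configE.
exact: (probability_config_pred (@mG n) (ER_indep (GER n)) (@PG n) (@q0 n)).
Qed.

(** Markov's inequality for the fourth power; the two bounds of order 1 / n make the moment O(n^-2),
    with 11 = 8 + 3. Graphs of different sizes may depend on each other arbitrarily, since
    Borel-Cantelli uses only the sum of the probabilities. *)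
Lemma ae_concentration (f : forall n, {ffun 'I_n * 'I_n -> bool} -> R)
    (c : nat -> R) (K eps : R) : 0 < eps ->
  (\forall n \near \oo, flip_lipschitz (c n) (@f n)) ->
  (\forall n \near \oo, c n ^+ 2 * \sum_e edge_prob (@p n) e <= K / n%:R) ->
  (\forall n \near \oo, c n ^+ 2 <= K / n%:R) ->
  {ae P, forall w, \forall n \near \oo,
    `|f n (graph_config n w) - expect (edge_prob (@p n)) (@f n)| <= eps}.
Proof.
move=> eps0 fc cq cc.
pose B n (g : {ffun 'I_n * 'I_n -> bool}) :=
  eps < `|f n g - expect (edge_prob (@p n)) (@f n)|.
have : {ae P, forall w, \forall n \near \oo, ~ [set w | B n (graph_config n w)] w}.
  apply: (@borel_cantelli_inv_square _ _ _ _ _ (11 * K ^+ 2 / eps ^+ 4)).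
    by move=> n; exact: measurable_graph_config.
  near=> n.
  rewrite probability_graph_config lee_fin.
  have q01 e : 0 <= edge_prob (@p n) e <= 1 by exact: edge_prob01.
  have e4 : 0 < eps ^+ 4 by rewrite exprn_gt0.
  rewrite mulrAC ler_pdivlMr// mulr_suml.
  apply: (@le_trans _ _ (expect (edge_prob (@p n))
     (fun g => (f n g - expect (edge_prob (@p n)) (@f n)) ^+ 4))).
    rewrite [leRHS](bigID (B n))/= -[leLHS]addr0; apply: lerD.
      apply: ler_sum => g Bg; rewrite ler_wpM2l ?config_weight_ge0//.
      rewrite -[leRHS](ger0_norm (exprn_even_ge0 _ _))// normrX.
      by rewrite lerXn2r ?nnegrE ?(ltW eps0)//; exact: ltW.
    apply: sumr_ge0 => g _; rewrite mulr_ge0 ?config_weight_ge0//.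
    by rewrite exprn_even_ge0.
  have fcn : flip_lipschitz (c n) (@f n) by near: n.
  apply: (le_trans (expect_fourth_moment q01 fcn)).
  have h1 : c n ^+ 2 * \sum_e edge_prob (@p n) e <= K / n%:R by near: n.
  have h2 : c n ^+ 2 <= K / n%:R by near: n.
  have c0 := sqr_ge0 (c n).
  set Q := \sum_e _ in h1 *.
  have Q0 : 0 <= Q by apply: sumr_ge0 => e _; have /andP[] := q01 e.
  have k0 : 0 <= K / n%:R by exact: le_trans h2.
  have a1 : (c n ^+ 2 * Q) ^+ 2 <= (K / n%:R) ^+ 2.
    by rewrite lerXn2r// nnegrE mulr_ge0.
  have a2 : c n ^+ 2 * (c n ^+ 2 * Q) <= (K / n%:R) ^+ 2.
    by rewrite expr2; apply: ler_pM => //; rewrite mulr_ge0.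
  have -> : 11 * K ^+ 2 / n%:R ^+ 2 = 11 * (K / n%:R) ^+ 2 by rewrite expr_div_n [RHS]mulrA.
  have -> : 3 * c n ^+ 4 * Q = 3 * (c n ^+ 2 * (c n ^+ 2 * Q)) by ring.
  lra.
apply: filterS => w; apply: filterS => n /= /negP; rewrite /B -leNgt.
exact.
Unshelve. all: by end_near. Qed.

End Concentration.

(** * Almost sure convergence *)

(** Both sides are tr A^2, in an eigenbasis and in the standard basis. *)
Lemma sum_eigval_sqr (R : rcfType) (n : nat) (A : 'M[R]_n) : A^T = A ->
  \sum_i eigval A i ^+ 2 = \sum_i \sum_j A i j ^+ 2.
Proof.
move=> As; apply: (@complexI R).
transitivity (\tr (cmx A *m cmx A)).
  have [_ E] := spectral_sym As.
  rewrite {1 2}E !mulmxA mulmxK ?spectral_unit// mxtrace_mulC !mulmxA.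
  rewrite mulmxV ?spectral_unit// mul1mx mulmx_diag mxtrace_diag rmorph_sum.
  by apply: eq_bigr => i _; rewrite !mxE -rmorphM expr2.
rewrite -map_mxM /mxtrace rmorph_sum; apply: eq_bigr => i _.
rewrite !mxE; congr (_%:C); apply: eq_bigr => j _.
have /matrixP/(_ i j) := As; rewrite mxE => ->; by rewrite expr2.
Qed.

Lemma esd_eigval (R : realType) (n : nat) (A : 'M[R]_n) (x : R) : A^T = A ->
  esd (cmx A) x = n%:R^-1 * \sum_(i < n) (eigval A i <= x)%R%:R.
Proof.
move=> As; rewrite /esd; congr (_ * _); apply: eq_bigr => i _.
by have [-> _] := spectral_sym As; rewrite lecR.
Qed.

Lemma adjacency_config (R : realType) (n : nat) (g : rel 'I_n) (c : R) :
  symmetric g -> irreflexive g ->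
  c%:C *: adjacency R g =
  cmx (c *: config_mx R [ffun e : 'I_n * 'I_n => (e.1 < e.2)%N && g e.1 e.2]).
Proof.
move=> gs gi; apply/matrixP => i j; rewrite !mxE rmorphM; congr (_ * _).
have -> : (if (i < j)%N then [ffun e : 'I_n * 'I_n => (e.1 < e.2)%N && g e.1 e.2] (i, j)
  else if (j < i)%N then [ffun e : 'I_n * 'I_n => (e.1 < e.2)%N && g e.1 e.2] (j, i)
  else false) = g i j.
  rewrite !ffunE /=; case: (ltngtP i j) => [//|_|/val_inj ->]; [exact: gs|by rewrite gi].
by case: (g i j).
Qed.

(** * Lipschitz statistics of the sparse graph *)

Section SparseGraph.
Variables (R : realType) (n : nat) (p : 'I_n -> 'I_n -> R) (h : R).
Hypotheses (p01 : forall i j, 0 <= p i j <= 1) (psym : forall i j, p i j = p j i).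
Hypotheses (h0 : 0 < h) (h1 : h <= 1) (prow : forall i, h ^+ 2 * \sum_j p i j <= 2).
Hypothesis n0 : (0 < n)%N.

Let nr0 : 0 < n%:R :> R. Proof. by rewrite ltr0n. Qed.

Lemma edge_prob_sum : h ^+ 2 * \sum_e edge_prob p e <= 2 * n%:R.
Proof.
apply: (@le_trans _ _ (h ^+ 2 * \sum_i \sum_j p i j)).
  rewrite ler_wpM2l ?sqr_ge0// pair_bigA/=; apply: ler_sum => -[i j] _ /=.
  by rewrite /edge_prob; case: ifP => // _; have /andP[] := p01 i j.
rewrite mulr_sumr; apply: (@le_trans _ _ (\sum_(i < n) 2)); first exact: ler_sum.
by rewrite sumr_const card_ord mulr_natr.
Qed.

(** The squared flip size times the expected number of edges is of order (h / n)^2 (n / h^2) = 1 /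
    n, whatever the growth of n alpha. *)
Lemma lipschitz_const_bound (k : R) : 0 <= k ->
  (k * h / n%:R) ^+ 2 * \sum_e edge_prob p e <= (2 * k ^+ 2) / n%:R /\
  (k * h / n%:R) ^+ 2 <= (2 * k ^+ 2) / n%:R.
Proof.
move=> k0; have k2 := sqr_ge0 k.
have n1 : 1 <= n%:R :> R by rewrite ler1n.
split.
  have -> : (k * h / n%:R) ^+ 2 * \sum_e edge_prob p e =
    k ^+ 2 / n%:R ^+ 2 * (h ^+ 2 * \sum_e edge_prob p e).
    by rewrite !exprMn exprVn; ring.
  apply: (@le_trans _ _ (k ^+ 2 / n%:R ^+ 2 * (2 * n%:R))).
    by rewrite ler_wpM2l ?edge_prob_sum// divr_ge0 ?sqr_ge0.
  by rewrite le_eqVlt; apply/orP; left; apply/eqP; field; rewrite gt_eqF.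
rewrite !exprMn exprVn ler_pdivlMr//.
have -> : k ^+ 2 * h ^+ 2 / n%:R ^+ 2 * n%:R = k ^+ 2 * (h ^+ 2 / n%:R).
  by field; rewrite gt_eqF.
rewrite mulrC ler_wpM2r//.
apply: (@le_trans _ _ 1); last by rewrite ler1n.
rewrite ler_pdivrMr// mul1r; apply: le_trans n1.
by rewrite expr_le1// ltW.
Qed.

Lemma arctan_count_lipschitz (eta a b : R) : 0 < eta -> a <= b ->
  flip_lipschitz ((b - a) * (2 * eta^-1 ^+ 2) * h / n%:R)
    (fun g : {ffun 'I_n * 'I_n -> bool} => arctan_count (h *: config_mx R g) eta b -
              arctan_count (h *: config_mx R g) eta a).
Proof.
move=> e0 ab g [i j]; have [ij|ij] := boolP (i < j)%N.
  have -> : (b - a) * (2 * eta^-1 ^+ 2) * h / n%:R =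
    (b - a) * (n%:R^-1 * (h * (2 * eta^-1 ^+ 2))) by ring.
  apply: (@arctan_count_flip _ _ _ _ _ _ _ _ i j) => //.
  - exact: scaled_config_sym.
  - exact: ltW.
  - by rewrite -scalerBr (@config_mx_flip R n g (i, j) ij).
rewrite !(@config_mx_nonedge _ _ g (i, j))// subrr normr0.
by rewrite divr_ge0// mulr_ge0 ?(ltW h0)// mulr_ge0 ?subr_ge0// mulr_ge0// sqr_ge0.
Qed.

(** This is n^-1 tr H^2, since adjacency entries equal their squares. It is linear in the edges and
    bounds the fraction of eigenvalues far from 0. *)
Definition edge_density (g : {ffun 'I_n * 'I_n -> bool}) : R :=
  n%:R^-1 * (h ^+ 2 * \sum_i \sum_j config_mx R g i j).

Lemma edge_density_eigval g :
  n%:R^-1 * \sum_i eigval (h *: config_mx R g) i ^+ 2 = edge_density g.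
Proof.
rewrite sum_eigval_sqr ?scaled_config_sym// /edge_density; congr (_ * _).
rewrite mulr_sumr; apply: eq_bigr => i _; rewrite mulr_sumr; apply: eq_bigr => j _.
rewrite [X in X ^+ 2]mxE exprMn; congr (_ * _); rewrite mxE.
by case: (if _ then _ else _); rewrite ?expr1n ?expr0n.
Qed.

Lemma edge_density_lipschitz : flip_lipschitz (2 * h / n%:R) edge_density.
Proof.
move=> g [i j]; have hn : 0 <= 2 * h / n%:R by rewrite divr_ge0// mulr_ge0// ltW.
have [ij|ij] := boolP (i < j)%N; last first.
  by rewrite /edge_density !(@config_mx_nonedge _ _ g (i, j))// subrr normr0.
rewrite /edge_density -mulrBr -mulrBr -sumrB.
rewrite (eq_bigr (fun k => \sum_l edge_mx R i j k l)); last first.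
  move=> k _; rewrite -sumrB; apply: eq_bigr => l _.
  by have /matrixP/(_ k l) := @config_mx_flip R n g (i, j) ij; rewrite mxE [X in _ + X]mxE.
have S (a b : 'I_n) : \sum_k \sum_l (delta_mx a b : 'M[R]_n) k l = 1.
  rewrite (bigD1 a)//= (bigD1 b)//= mxE !eqxx big1 ?addr0; last first.
    by move=> l /negbTE lb; rewrite mxE lb andbF.
  by rewrite big1 ?addr0// => k /negbTE ka; rewrite big1// => l _; rewrite mxE ka.
have -> : \sum_k \sum_l edge_mx R i j k l = 2.
  rewrite (eq_bigr (fun k => \sum_l (delta_mx i j : 'M[R]_n) k l +
     \sum_l (delta_mx j i : 'M[R]_n) k l)) => [|k _].
    by rewrite big_split/= !S.
  by rewrite -big_split; apply: eq_bigr => l _; rewrite mxE.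
rewrite ger0_norm; last by rewrite mulr_ge0 ?invr_ge0// mulr_ge0// sqr_ge0.
(* A flip moves two entries, each weighted by h^2; h <= 1 brings the constant to the common form k h
   / n. *)
rewrite mulrC ler_pM2r ?invr_gt0// mulrC ler_pM2l// expr2 ler_piMr ?(ltW h0)//.
Qed.

Lemma expect_edge_density : expect (edge_prob p) edge_density <= 2.
Proof.
have q01 e : 0 <= edge_prob p e <= 1 by exact: edge_prob01.
rewrite /edge_density !expectZ expect_sum ler_pdivrMl// [n%:R * 2]mulrC.
rewrite mulr_sumr; apply: (@le_trans _ _ (\sum_(i < n) 2)); last first.
  by rewrite sumr_const card_ord mulr_natr.
apply: ler_sum => i _; apply: le_trans (prow i).
rewrite ler_wpM2l ?sqr_ge0// expect_sum; apply: ler_sum => j _.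
have /andP[p0 _] := p01 i j.
have [->|ij] := eqVneq i j.
  rewrite (eq_expect _ (f2 := fun=> 0)); last by move=> g; exact: config_mx_diag.
  by rewrite expect_cst; have /andP[] := p01 j j.
rewrite (eq_expect _ (f2 := fun g => (g (edge_of i j))%:R * 1)); last first.
  by move=> g; rewrite config_mxE// mulr1.
by rewrite expect_coord expect_cst mulr1 edge_probE.
Qed.

End SparseGraph.

(** * Comparing eigenvalue counts with smoothed counts *)

Section Sandwich.
Variables (R : realType) (n : nat) (A : 'M[R]_n) (eta delta e L x b : R).
Hypotheses (eta0 : 0 < eta) (delta1 : delta <= 1) (e0 : 0 <= e).
Hypotheses (L1 : 1 < L) (Lb : - L <= b).
Hypothesis atan_delta : pi / 2 - e <= atan (delta / eta).

Let atan_far (u : R) : delta <= u -> pi / 2 - e <= atan (u / eta).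
Proof.
move=> u1; apply: (le_trans atan_delta); apply: le_atan.
by rewrite ler_pM2r// invr_gt0.
Qed.

Let mass_ge0 (l : R) : 0 <= atan ((b - l) / eta) - atan ((- L - l) / eta).
Proof. by rewrite subr_ge0 le_atan// ler_pM2r ?invr_gt0// lerD2r. Qed.

(** Three ranges of [l]. Up to 1 - L the quadratic term alone is at least pi. From there to [x] both
    arctangents are within [e] of their limits, which costs 2 e. Beyond [x] the right side is
    nonnegative. *)
Lemma indicator_le_mass (l : R) : x + delta <= b ->
  pi * (l <= x)%R%:R <= pi * (l ^+ 2 / (L - 1) ^+ 2) +
    (atan ((b - l) / eta) - atan ((- L - l) / eta)) + 2 * e.
Proof.
move=> xb; have m0 := mass_ge0 l.
have L10 : 0 < (L - 1) ^+ 2 by rewrite exprn_gt0// subr_gt0.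
have q0 : 0 <= pi * (l ^+ 2 / (L - 1) ^+ 2).
  by rewrite mulr_ge0 ?pi_ge0// divr_ge0 ?sqr_ge0// ltW.
case: (leP l x) => lx; rewrite ?mulr1 ?mulr0; last by have := e0; lra.
have [lL|lL] := leP l (1 - L).
  have : 1 <= l ^+ 2 / (L - 1) ^+ 2.
    rewrite ler_pdivlMr// mul1r -[leRHS]sqrrN.
    by rewrite lerXn2r ?nnegrE//; have := L1; lra.
  by move=> /(ler_wpM2l (pi_ge0 R)); rewrite mulr1; have := e0; lra.
have a1 : pi / 2 - e <= atan ((b - l) / eta) by apply: atan_far; lra.
have a2 : pi / 2 - e <= atan ((L + l) / eta) by apply: atan_far; have := delta1; lra.
have -> : (- L - l) / eta = - ((L + l) / eta) by rewrite -mulNr opprD.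
by rewrite atanN; lra.
Qed.

(** The mass is below pi, and for l > x it is at most [e], because [b] lies at least [delta] to the
    left of [l]. *)
Lemma mass_le_indicator (l : R) : b + delta <= x ->
  atan ((b - l) / eta) - atan ((- L - l) / eta) <= pi * (l <= x)%R%:R + e.
Proof.
move=> bx; have u1 := atan_ltpi2 ((b - l) / eta).
have u2 := atan_gtNpi2 ((- L - l) / eta).
case: (leP l x) => lx; rewrite ?mulr1 ?mulr0; first by have := e0; lra.
have a1 : pi / 2 - e <= atan ((l - b) / eta) by apply: atan_far; lra.
have -> : (b - l) / eta = - ((l - b) / eta) by rewrite -mulNr opprB.
by rewrite atanN; lra.
Qed.

Hypotheses (As : A^T = A) (n0 : (0 < n)%N).

Let nr0 : 0 < n%:R :> R. Proof. by rewrite ltr0n. Qed.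

Let mass := arctan_count A eta b - arctan_count A eta (- L).

Let massE : mass =
  n%:R^-1 * \sum_i (atan ((b - eigval A i) / eta) - atan ((- L - eigval A i) / eta)).
Proof. by rewrite /mass /arctan_count -mulrBr -sumrB. Qed.

Lemma esd_le_mass : x + delta <= b -> pi * esd (cmx A) x <=
  pi * ((n%:R^-1 * \sum_i eigval A i ^+ 2) / (L - 1) ^+ 2) + mass + 2 * e.
Proof.
move=> xb; rewrite esd_eigval// massE.
have -> : 2 * e = n%:R^-1 * \sum_(i < n) 2 * e.
  by rewrite sumr_const card_ord -[2 * e *+ n]mulr_natl mulKf// gt_eqF.
have -> : pi * ((n%:R^-1 * \sum_i eigval A i ^+ 2) / (L - 1) ^+ 2) =
  n%:R^-1 * \sum_i (pi * (eigval A i ^+ 2 / (L - 1) ^+ 2)).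
  by rewrite -mulr_sumr -mulr_suml; ring.
rewrite -!mulrDr -!big_split/= mulrCA ler_wpM2l ?invr_ge0 ?(ltW nr0)//.
by rewrite mulr_sumr; apply: ler_sum => i _; exact: indicator_le_mass.
Qed.

Lemma mass_le_esd : b + delta <= x -> mass <= pi * esd (cmx A) x + e.
Proof.
move=> bx; rewrite esd_eigval// massE.
have -> : e = n%:R^-1 * \sum_(i < n) e.
  by rewrite sumr_const card_ord -[e *+ n]mulr_natl mulKf// gt_eqF.
rewrite mulrCA -mulrDr ler_wpM2l ?invr_ge0 ?(ltW nr0)//.
rewrite mulr_sumr -big_split/=; apply: ler_sum => i _; exact: mass_le_indicator.
Qed.

End Sandwich.

(** * Choice of parameters and passage to the limit *)

Section SemicircleLimit.
Variables (R : realType) (d : measure_display) (Omega : measurableType d)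
  (P : probability Omega R) (p : forall n : nat, 'I_n -> 'I_n -> R)
  (G : forall n : nat, Omega -> rel 'I_n) (alpha : nat -> R) (C : R).
Hypotheses (p01 : forall (n : nat) (i j : 'I_n), 0 <= p i j <= 1)
  (psym : forall (n : nat) (i j : 'I_n), p i j = p j i)
  (GER : forall n : nat, inhomogeneous_ER P (@p n) (@G n))
  (alpha0 : alpha n @[n --> \oo] --> (0 : R))
  (nalpha : n%:R * alpha n @[n --> \oo] --> +oo)
  (psum : forall eps : R, 0 < eps -> \forall n \near \oo, forall j : 'I_n,
     `|\sum_(i < n) p i j - n%:R * alpha n| <= eps * (n%:R * alpha n))
  (C1 : 1 <= C)
  (pmax : forall (n : nat) (i j : 'I_n), p i j <= C * alpha n).

Let h n : R := (Num.sqrt (n%:R * alpha n))^-1.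

(** For the finitely many n with n alpha <= 0 the value of [h] is 0; all later estimates are
    eventual in n. *)
Let near_h : \forall n \near \oo, 0 < h n /\ h n ^+ 2 * (n%:R * alpha n) = 1.
Proof.
move/cvgryPgt : (nalpha) => /(_ 0); apply: filterS => n na0.
rewrite /h invr_gt0 sqrtr_gt0; split=> //.
by rewrite exprVn sqr_sqrtr ?(ltW na0)// mulVf// gt_eqF.
Qed.

Let near_h_small (eps : R) : 0 < eps -> \forall n \near \oo, h n <= eps.
Proof.
move=> eps0; move/cvgryPge : (nalpha) => /(_ (eps^-1 ^+ 2)); apply: filterS => n na.
rewrite /h -[leRHS]invrK lef_pV2 ?posrE ?invr_gt0//.
  by rewrite -[leLHS]ger0_norm ?invr_ge0 ?(ltW eps0)// -sqrtr_sqr ler_wsqrtr.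
by rewrite sqrtr_gt0 (lt_le_trans _ na)// exprn_gt0 ?invr_gt0.
Qed.

Let near_alpha_small (eps : R) : 0 < eps -> \forall n \near \oo, alpha n <= eps.
Proof.
move=> eps0; move/cvgrPdist_le : (alpha0) => /(_ eps eps0); apply: filterS => n.
by rewrite sub0r normrN; apply: le_trans; exact: ler_norm.
Qed.

Let near_row (eps : R) : 0 < eps -> \forall n \near \oo, forall i : 'I_n,
  `|\sum_j h n ^+ 2 * p i j - 1| <= eps.
Proof.
move=> eps0; near=> n; move=> i.
have [h0 hna] : 0 < h n /\ h n ^+ 2 * (n%:R * alpha n) = 1 by near: n; exact: near_h.
have : `|\sum_(j < n) p j i - n%:R * alpha n| <= eps * (n%:R * alpha n).
  by move: i; near: n; exact: psum.
move=> H; rewrite -mulr_sumr -hna -mulrBr normrM (ger0_norm (sqr_ge0 _)).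
rewrite (eq_bigr (fun j => p j i)) => [|j _]; last exact: psym.
apply: le_trans (ler_wpM2l (sqr_ge0 _) H) _.
by rewrite mulrCA hna mulr1.
Unshelve. all: by end_near. Qed.

Let near_row2 : \forall n \near \oo, forall i : 'I_n, h n ^+ 2 * \sum_j p i j <= 2.
Proof.
have := near_row ltr01; apply: filterS => n H i; have := H i.
by rewrite -mulr_sumr ler_norml => /andP[_]; lra.
Qed.

(** The distance of Im m from its boundary value, made uniform in x on [a, b] by |x| <= |a| +
    |b|. *)
Let smoothing_error (eta a b : R) : R := Num.sqrt (eta ^+ 2 + (`|a| + `|b|) * eta) / 2.

Let near_expect (a b eta delta : R) : 0 < eta -> eta <= 1 -> a <= b -> 0 < delta ->
  \forall n \near \oo,
  `|expect (edge_prob (@p n))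
      (fun g : {ffun 'I_n * 'I_n -> bool} => arctan_count (h n *: config_mx R g) eta b -
                arctan_count (h n *: config_mx R g) eta a) -
    pi * (semicircle_cdf b - semicircle_cdf a)| <=
  (b - a) * (smoothing_error eta a b + delta).
Proof.
move=> e0 e1 ab d0.
(* Budget: [t] takes delta / 4, and 3 t' multiplied by [St] takes 3 delta / 4. With [s] as below the
   defect term is at most 2 s Dc / t' = t'. The added 1 in [St] and [Dc] keeps the divisors
   positive. *)
pose M := `|a| + `|b|; pose B := M + 1; pose t := delta / 4.
have t0 : 0 < t by rewrite divr_gt0.
pose St := `|stability_const eta B t| + 1.
have St0 : 0 < St by rewrite ltr_wpDl.
pose t' := delta / (4 * St).
have t'0 : 0 < t' by rewrite divr_gt0// mulr_gt0.
pose Dc := `|defect_const B eta^-1| + 1.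
have Dc0 : 0 < Dc by rewrite ltr_wpDl.
pose s := t' * t' / (2 * Dc).
have s0 : 0 < s by apply: divr_gt0; apply: mulr_gt0.
pose eps := Num.min t' (eta ^+ 2 / 2).
have eps0 : 0 < eps by rewrite lt_min t'0 divr_gt0 ?exprn_gt0.
have C0 : 0 < C by exact: lt_le_trans C1.
(* [s1] bounds the square root of the edge probabilities; the cap 1/2 ensures s1^2 <= 1/2. *)
pose s1 := Num.min s (2^-1).
have s10 : 0 < s1 by rewrite lt_min s0/= invr_gt0.
near=> n.
have [h0 hna] : 0 < h n /\ h n ^+ 2 * (n%:R * alpha n) = 1 by near: n; exact: near_h.
have h1 : h n <= 1 by near: n; exact: near_h_small.
have hs : h n <= s by near: n; exact: near_h_small.
have al : alpha n <= s1 ^+ 2 / C.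
  by near: n; apply: near_alpha_small; rewrite divr_gt0 ?exprn_gt0.
have row : forall i : 'I_n, `|\sum_j h n ^+ 2 * p i j - 1| <= eps.
  by near: n; exact: near_row.
have row2 : forall i : 'I_n, h n ^+ 2 * \sum_j p i j <= 2 by near: n; exact: near_row2.
have n0 : (0 < n)%N by near: n; exact: nbhs_infty_gt.
have pr (i j : 'I_n) : p i j <= s1 ^+ 2.
  apply: (le_trans (pmax i j)); by rewrite mulrC -ler_pdivlMr.
have s12 : s1 ^+ 2 <= 2^-1.
  have : s1 <= 2^-1 by rewrite ge_min lexx orbT.
  by have := s10; nra.
apply: expect_arctan_count => // x /andP[ax xb].
have xM : `|x| <= M.
  rewrite /M ler_norml; apply/andP; split.
    by apply: le_trans ax; have := ler_norm (- a); rewrite normrN; have := normr_ge0 b; lra.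
  by apply: (le_trans xb); have := ler_norm b; have := normr_ge0 a; lra.
have zB : normc (x +i* eta) <= B.
  rewrite (_ : x +i* eta = x%:C + 'i * eta%:C); last first.
    by apply/eqP; rewrite eq_complex/= !(mul0r, mul1r, mulr0, subr0, addr0, add0r) !eqxx.
  apply: (le_trans (ler_normcD _ _)); rewrite normc_real normcM normc_real.
  rewrite (_ : normc 'i = 1) ?mul1r; last by rewrite /= expr0n expr1n add0r sqrtr1.
  by apply: lerD => //; rewrite ger0_norm// ltW.
have [m m0 mz] := @semicircle_root_exists R (x +i* eta) e0.
have p0 (i j : 'I_n) : 0 <= p i j by have /andP[] := p01 i j.
have e2 : eps <= complex.Im (x +i* eta) ^+ 2 / 2 by rewrite ge_min lexx orbT.
have main := @expect_stieltjes R n (@p n) (x +i* eta) B (h n) s1 p0 (@psym n) (ltW s10)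
  s12 pr h0 h1 row2 e0 e1 zB m eps t t' m0 mz (ltW eps0) e2 row t0 t'0 n0.
have sq := Im_semicircle_root e0 m0 mz.
have rho : pi * semicircle_density x = Num.sqrt (4 - x ^+ 2) / 2.
  rewrite semicircle_densityE mulrA mulrC; congr (_ * _).
  by rewrite invfM mulrCA mulfV ?mulr1// gt_eqF// pi_gt0.
rewrite rho; apply: le_trans (ler_distD (complex.Im m) _ _) _.
rewrite addrC; apply: lerD.
  apply: (le_trans sq); rewrite ler_pM2r ?invr_gt0// ler_wsqrtr// lerD2l ler_wpM2r//.
  exact: ltW.
apply: (le_trans main).
pose Dq := defect_const B eta^-1 * (s1 + h n) / t'.
have s1s : s1 <= s by rewrite ge_min lexx.
have Dq_le : `|Dq| <= t'.
  rewrite /Dq !normrM (ger0_norm (_ : 0 <= t'^-1)) ?invr_ge0 ?(ltW t'0)//.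
  rewrite ler_pdivrMr// (ger0_norm (_ : 0 <= s1 + h n)) ?(addr_ge0 (ltW s10) (ltW h0))//.
  apply: (@le_trans _ _ (Dc * (s + s))).
    by apply: ler_pM; rewrite ?addr_ge0 ?(ltW s10) ?(ltW h0) ?lerD// lerDl.
  rewrite /s le_eqVlt; apply/orP; left; apply/eqP; field.
  by rewrite gt_eqF.
have X_le : `|t' + Dq + eps| <= 3 * t'.
  apply: (le_trans (ler_normD _ _)); rewrite (gtr0_norm eps0).
  have e1' : eps <= t' by rewrite ge_min lexx.
  apply: le_trans (lerD (ler_normD t' Dq) e1') _; rewrite (gtr0_norm t'0).
  have -> : 3 * t' = t' + t' + t' by ring.
  by rewrite !lerD.
have St_le : stability_const eta B t * (t' + Dq + eps) <= St * (3 * t').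
  apply: (le_trans (ler_norm _)); rewrite normrM; apply: ler_pM => //.
  by rewrite lerDl.
have St_eq : St * (3 * t') = 3 * delta / 4 by rewrite /t'; field; rewrite gt_eqF.
rewrite -[X in X <= _]/(t + stability_const eta B t * (t' + Dq + eps)).
apply: le_trans (lerD (lexx t) St_le) _; rewrite St_eq /t; lra.
Unshelve. all: by end_near. Qed.

Let cfg n w := graph_config G n w.

Let arctan_mass (eta a b : R) n (g : {ffun 'I_n * 'I_n -> bool}) : R :=
  arctan_count (h n *: config_mx R g) eta b - arctan_count (h n *: config_mx R g) eta a.

Let near_h1 : \forall n \near \oo, h n <= 1. Proof. exact: near_h_small. Qed.

Let near_lipschitz (k : R) : 0 <= k -> \forall n \near \oo,
  (k * h n / n%:R) ^+ 2 * \sum_e edge_prob (@p n) e <= (2 * k ^+ 2) / n%:R /\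
  (k * h n / n%:R) ^+ 2 <= (2 * k ^+ 2) / n%:R.
Proof.
move=> k0; near=> n.
have [h0 hna] : 0 < h n /\ h n ^+ 2 * (n%:R * alpha n) = 1 by near: n; exact: near_h.
apply: lipschitz_const_bound => //.
- by near: n; exact: near_h1.
- by near: n; exact: near_row2.
- by near: n; exact: nbhs_infty_gt.
Unshelve. all: by end_near. Qed.

Let ae_arctan_mass (eta a b eps : R) : 0 < eta -> eta <= 1 -> a <= b -> 0 < eps ->
  {ae P, forall w, \forall n \near \oo,
    `|arctan_mass eta a b (cfg n w) - pi * (semicircle_cdf b - semicircle_cdf a)| <=
    (b - a) * smoothing_error eta a b + eps}.
Proof.
move=> e0 e1 ab eps0.
(* Half of [eps] pays for the fluctuation and half for the expectation; the + 1 covers a = b. *)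
pose delta := eps / 2 / (b - a + 1).
have ba : 0 < b - a + 1 by rewrite ltr_wpDl// subr_ge0.
have eps2 : 0 < eps / 2 by rewrite divr_gt0.
have d0 : 0 < delta by rewrite divr_gt0.
pose k := (b - a) * (2 * eta^-1 ^+ 2).
have k0 : 0 <= k by rewrite mulr_ge0 ?subr_ge0// mulr_ge0// sqr_ge0.
have conc := @ae_concentration R d Omega P p G p01 GER (arctan_mass eta a b)
  (fun n => k * h n / n%:R) (2 * k ^+ 2) (eps / 2) eps2.
have : {ae P, forall w, \forall n \near \oo, `|arctan_mass eta a b (cfg n w) -
    expect (edge_prob (@p n)) (@arctan_mass eta a b n)| <= eps / 2}.
  apply: conc.
  - near=> n; apply: arctan_count_lipschitz => //.
    by near: n; apply: filterS near_h => n [].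
  - by have := near_lipschitz k0; apply: filterS => n [].
  - by have := near_lipschitz k0; apply: filterS => n [].
apply: filterS => w H; near=> n.
have h1 : `|arctan_mass eta a b (cfg n w) -
    expect (edge_prob (@p n)) (@arctan_mass eta a b n)| <= eps / 2 by near: n.
have h2 : `|expect (edge_prob (@p n)) (@arctan_mass eta a b n) -
    pi * (semicircle_cdf b - semicircle_cdf a)| <= (b - a) * (smoothing_error eta a b + delta).
  by near: n; exact: near_expect.
apply: le_trans (ler_distD (expect (edge_prob (@p n)) (@arctan_mass eta a b n)) _ _) _.
apply: (le_trans (lerD h1 h2)).
rewrite mulrDr addrCA lerD2l -lerBrDl.
have -> : eps - eps / 2 = (b - a + 1) * delta by rewrite /delta; field; rewrite gt_eqF.
by rewrite ler_pM2r// lerDl.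
Unshelve. all: by end_near. Qed.

Let ae_edge_density : {ae P, forall w, \forall n \near \oo,
  edge_density (h n) (cfg n w) <= 3}.
Proof.
have : {ae P, forall w, \forall n \near \oo, `|edge_density (h n) (cfg n w) -
    expect (edge_prob (@p n)) (edge_density (h n))| <= 1}.
  have ge2 : 0 <= 2 :> R by [].
  apply: (@ae_concentration R d Omega P p G p01 GER (fun n => edge_density (h n))
    (fun n => 2 * h n / n%:R) (2 * 2 ^+ 2) 1) => //.
  - near=> n; apply: edge_density_lipschitz => //.
    + by near: n; apply: filterS near_h => n [].
    + by near: n; exact: near_h1.
    + by near: n; exact: nbhs_infty_gt.
  - by have := near_lipschitz ge2; apply: filterS => n [].
  - by have := near_lipschitz ge2; apply: filterS => n [].
apply: filterS => w H; near=> n.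
have h1 : `|edge_density (h n) (cfg n w) -
    expect (edge_prob (@p n)) (edge_density (h n))| <= 1 by near: n.
have h2 : expect (edge_prob (@p n)) (edge_density (h n)) <= 2.
  apply: expect_edge_density => //.
  - by near: n; exact: near_row2.
  - by near: n; exact: nbhs_infty_gt.
by move: h1; rewrite ler_norml => /andP[_]; lra.
Unshelve. all: by end_near. Qed.

(** The error is multiplied by the length of the interval, up to 2 L, so [eta] has to be small in
    terms of [L]. *)
Let smoothing_error_small (L b e eta : R) : 0 < e -> 0 < eta -> eta <= 1 ->
  1 <= L -> `|b| <= L -> (1 + 2 * L) * eta <= (e / L) ^+ 2 ->
  (b - - L) * smoothing_error eta (- L) b <= e.
Proof.
move=> e0 eta0 eta1 L1 bL H.
have L0 : 0 < L by exact: lt_le_trans L1.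
have eL : 0 <= e / L by rewrite divr_ge0 ?ltW.
rewrite /smoothing_error; set u := Num.sqrt _.
have u_le : u <= e / L.
  rewrite -[leRHS]ger0_norm// -sqrtr_sqr ler_wsqrtr//; apply: le_trans H.
  rewrite normrN (gtr0_norm L0) [leRHS]mulrDl mul1r; apply: lerD.
    by rewrite expr2 ler_piMr ?(ltW eta0).
  by rewrite ler_pM2r//; lra.
have bL2 : b - - L <= 2 * L by have := ler_norm b; lra.
apply: (@le_trans _ _ (2 * L * (e / L / 2))).
  apply: ler_pM => //; last by rewrite ler_pM2r.
    by move: bL; rewrite ler_norml => /andP[]; lra.
  by rewrite divr_ge0// sqrtr_ge0.
by rewrite le_eqVlt; apply/orP; left; apply/eqP; field; rewrite gt_eqF.
Qed.

(* Countably many parameters, so that almost surely all these counts converge. *)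
Let smoothed_convergence m w : Prop :=
  if @unpickle (rat * nat * nat * nat)%type m is Some (r, k, l, j) then
    `|ratr r| <= l.+2%:R :> R -> \forall n \near \oo,
    `|arctan_mass k.+1%:R^-1 (- l.+2%:R) (ratr r) (cfg n w) - pi * semicircle_cdf (ratr r)| <=
    (ratr r - - l.+2%:R) * smoothing_error k.+1%:R^-1 (- l.+2%:R) (ratr r) + j.+1%:R^-1
  else True.

Let ae_smoothed_convergence : {ae P, forall w m, smoothed_convergence m w}.
Proof.
apply: ae_foralln => m; rewrite /smoothed_convergence.
case: unpickle => [[[[r k] l] j]|]; last exact: aeW.
have [rl|rl] := boolP (`|ratr r| <= l.+2%:R :> R); last exact: aeW.
have lr : - l.+2%:R <= ratr r :> R by move: rl; rewrite ler_norml => /andP[].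
have k0 : 0 < k.+1%:R^-1 :> R by rewrite invr_gt0.
have k1 : k.+1%:R^-1 <= 1 :> R by rewrite invf_le1// ler1n.
have j0 : 0 < j.+1%:R^-1 :> R by rewrite invr_gt0.
have := ae_arctan_mass k0 k1 lr j0.
apply: filterS => w H _; move: H; apply: filterS => n.
(* The shift by 2 puts the left endpoint at or below -2, outside the interior of the support. *)
rewrite (_ : semicircle_cdf (- l.+2%:R) = 0) ?subr0//.
by apply: semicircle_cdf_eq0; rewrite lerN2 (ler_nat _ 2).
Qed.

Let rat_near (x y : R) : x < y -> exists r : rat, x < ratr r < y.
Proof. by move=> /rat_in_itvoo[r]; rewrite in_itv/=; exists r. Qed.

Lemma ae_weak_cvg_semicircle : {ae P, forall w,
  weak_cvg (fun n => esd ((h n)%:C *: adjacency R (@G n w))) (@semicircle_cdf R)}.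
Proof.
move: ae_smoothed_convergence ae_edge_density; apply: filterS2 => w Sw Dw x cx.
apply/cvgrPdist_le => eps eps0.
(* The upper bound costs pi e for continuity, pi e for the tail and 4 e for smoothing and
   arctangents; 2 <= pi turns the total into at most 4 pi e. The lower bound costs less. *)
pose e := eps / 4.
have e0 : 0 < e by rewrite divr_gt0.
move/cvgrPdist_le : (cx) => /(_ e e0) /nbhs_ballP[d0 /= d00 xd0].
pose delta := Num.min (d0 / 2) 1.
have delta0 : 0 < delta by rewrite lt_min ltr01 andbT divr_gt0.
have delta1 : delta <= 1 by rewrite ge_min lexx orbT.
have deltad : delta <= d0 / 2 by rewrite ge_min lexx.
(* The endpoints are rational, to belong to the countable family. They are more than [delta] from
   [x], to separate the indicator from the smoothed step, and less than 2 delta <= d0, for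
   continuity. *)
have [r1 /andP[r1l r1r]] := @rat_near (x + delta) (x + 2 * delta) ltac:(lra).
have [r0 /andP[r0l r0r]] := @rat_near (x - 2 * delta) (x - delta) ltac:(lra).
have F1 : `|semicircle_cdf x - semicircle_cdf (ratr r1)| <= e.
  by apply: xd0; rewrite /ball/= ltr_norml; apply/andP; split; lra.
have F0 : `|semicircle_cdf x - semicircle_cdf (ratr r0)| <= e.
  by apply: xd0; rewrite /ball/= ltr_norml; apply/andP; split; lra.
(* [L] dominates both endpoints and makes 3 / (L - 1)^2 <= e, where 3 is the almost sure eventual
   bound on the edge density. *)
pose l := Num.bound (`|x| + 2 + 3 / e); pose L : R := l.+2%:R.
have lP : `|x| + 2 + 3 / e < l%:R.
  apply: archi_boundP; apply: addr_ge0; first by rewrite addr_ge0.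
  by rewrite divr_ge0 ?(ltW e0).
have LE : L = l%:R + 2 by rewrite /L -[l.+2]addn2 natrD.
have x0 := normr_ge0 x; have e3 : 0 < 3 / e by rewrite divr_gt0.
have L1 : 1 < L by lra.
have L1e : 3 / (L - 1) ^+ 2 <= e.
  have p1 : 1 <= L - 1 by lra.
  rewrite ler_pdivrMr ?exprn_gt0//; last by lra.
  have : 3 <= e * (L - 1).
    have : 3 / e <= L - 1 by lra.
    by rewrite ler_pdivrMr// mulrC.
  by rewrite expr2; nra.
have xl := ler_norm x; have xl' : - x <= `|x| by rewrite -normrN ler_norm.
have r1L : `|ratr r1| <= L by rewrite ler_norml; apply/andP; split; lra.
have r0L : `|ratr r0| <= L by rewrite ler_norml; apply/andP; split; lra.
have [M [_ HM]] : \forall u \near +oo, `|pi / 2 - atan u| <= e.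
  by move/cvgrPdist_le : (@cvgy_atan R) => /(_ e e0).
(* [eta] is chosen after [L]. The first term brings atan (delta / eta) within [e] of pi / 2, the
   second makes the accumulated smoothing error at most [e]. *)
pose K := (`|M| + 1) / delta + (1 + 2 * L) / (e / L) ^+ 2.
have a1 : 0 < (`|M| + 1) / delta by rewrite divr_gt0// ltr_wpDl.
have a2 : 0 < (1 + 2 * L) / (e / L) ^+ 2.
  by rewrite divr_gt0 ?exprn_gt0 ?divr_gt0//; lra.
pose k := Num.bound K.
have kP : K < k%:R by apply: archi_boundP; rewrite addr_ge0 ?ltW.
pose eta : R := k.+1%:R^-1.
have eta0 : 0 < eta by rewrite invr_gt0.
have eta1 : eta <= 1 by rewrite invf_le1// ler1n.
have kK : K < k.+1%:R by rewrite (lt_trans kP)// ltr_nat.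
have atan_delta : pi / 2 - e <= atan (delta / eta).
  have : `|pi / 2 - atan (delta / eta)| <= e.
    apply: HM; rewrite /eta invrK mulrC -ltr_pdivrMr//.
    have M1 : (`|M| + 1) / delta < k.+1%:R by apply: lt_trans kK; rewrite /K ltrDl.
    apply: le_lt_trans M1.
    by rewrite ler_pM2r ?invr_gt0//; have := ler_norm M; lra.
  by rewrite ler_norml => /andP[_]; lra.
have small : (1 + 2 * L) * eta <= (e / L) ^+ 2.
  have L0 : 0 < L by lra.
  rewrite /eta ler_pdivrMr// [leRHS]mulrC -ler_pdivrMr; last by rewrite exprn_gt0// divr_gt0.
  by apply: ltW; apply: lt_trans kK; rewrite /K ltrDr; exact: a1.
pose j := Num.bound e^-1.
have jP : j.+1%:R^-1 <= e.
  rewrite -[leRHS]invrK lef_pV2 ?posrE ?invr_gt0// ltW//.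
  by apply: (@lt_trans _ _ j%:R); rewrite ?ltr_nat//; apply: archi_boundP; rewrite invr_ge0 ltW.
have S1 := Sw (pickle (r1, k, l, j)); have S0 := Sw (pickle (r0, k, l, j)).
rewrite /smoothed_convergence !pickleK in S1 S0.
have L1' := ltW L1.
have s1 := smoothing_error_small e0 eta0 eta1 L1' r1L small.
have s0 := smoothing_error_small e0 eta0 eta1 L1' r0L small.
near=> n.
have T1 : `|arctan_mass eta (- L) (ratr r1) (cfg n w) - pi * semicircle_cdf (ratr r1)| <= 2 * e.
  apply: (@le_trans _ _ ((ratr r1 - - L) * smoothing_error eta (- L) (ratr r1) + j.+1%:R^-1)).
    by near: n; exact: S1.
  by apply: le_trans (lerD s1 jP) _; rewrite [leRHS]mulr_natl mulr2n.
have T0 : `|arctan_mass eta (- L) (ratr r0) (cfg n w) - pi * semicircle_cdf (ratr r0)| <= 2 * e.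
  apply: (@le_trans _ _ ((ratr r0 - - L) * smoothing_error eta (- L) (ratr r0) + j.+1%:R^-1)).
    by near: n; exact: S0.
  by apply: le_trans (lerD s0 jP) _; rewrite [leRHS]mulr_natl mulr2n.
have n0 : (0 < n)%N by near: n; exact: nbhs_infty_gt.
have D3 : edge_density (h n) (cfg n w) <= 3 by near: n.
have AE : (h n)%:C *: adjacency R (@G n w) = cmx (h n *: config_mx R (cfg n w)).
  exact: (adjacency_config (h n) (ER_sym (GER n) w) (ER_irr (GER n) w)).
rewrite AE; set A := h n *: config_mx R (cfg n w).
have As : A^T = A by exact: scaled_config_sym.
have D3' : n%:R^-1 * \sum_i eigval A i ^+ 2 <= 3 by rewrite edge_density_eigval.
have r1L' : - L <= ratr r1 by have := r1L; rewrite ler_norml => /andP[].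
have r0L' : - L <= ratr r0 by have := r0L; rewrite ler_norml => /andP[].
have up := esd_le_mass eta0 delta1 (ltW e0) L1 r1L' atan_delta As n0 (ltW r1l).
have lo : arctan_count A eta (ratr r0) - arctan_count A eta (- L) <= pi * esd (cmx A) x + e.
  by apply: (mass_le_esd L eta0 (ltW e0) atan_delta As n0); lra.
have tail : (n%:R^-1 * \sum_i eigval A i ^+ 2) / (L - 1) ^+ 2 <= e.
  apply: le_trans L1e; rewrite ler_pM2r// invr_gt0 exprn_gt0//; lra.
have p2 : 2 <= pi :> R by exact: pi_ge2.
have p0 : 0 < pi :> R by lra.
move: T1 T0 F1 F0; rewrite /arctan_mass -/A !ler_norml.
move=> /andP[_ T1] /andP[T0 _] /andP[F1 _] /andP[_ F0].
have up' : pi * esd (cmx A) x <= pi * (semicircle_cdf x + 4 * e).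
  have q1 : pi * ((n%:R^-1 * \sum_i eigval A i ^+ 2) / (L - 1) ^+ 2) <= pi * e by rewrite ler_pM2l.
  have q2 : pi * semicircle_cdf (ratr r1) <= pi * (semicircle_cdf x + e) by rewrite ler_pM2l//; lra.
  have q3 : 2 * e <= pi * e by rewrite ler_pM2r.
  by move: up q2; rewrite !mulrDr; lra.
have lo' : pi * (semicircle_cdf x - 4 * e) <= pi * esd (cmx A) x.
  have q2 : pi * (semicircle_cdf x - e) <= pi * semicircle_cdf (ratr r0) by rewrite ler_pM2l//; lra.
  have q3 : 2 * e <= pi * e by rewrite ler_pM2r.
  by move: lo q2; rewrite !mulrBr; lra.
rewrite ler_pM2l// in up'; rewrite ler_pM2l// in lo'.
have e4 : 4 * e = eps by rewrite /e; field.
by rewrite e4 in up' lo'; apply/andP; split; lra.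
Unshelve. all: by end_near. Qed.

End SemicircleLimit.

Unset Implicit Arguments.

Theorem corollary4p3 (R : realType) (d : measure_display)
    (Omega : measurableType d) (P : probability Omega R)
    (p : forall n : nat, 'I_n -> 'I_n -> R)
    (G : forall n : nat, Omega -> rel 'I_n)
    (alpha : nat -> R) (C : R)
    (p01 : forall (n : nat) (i j : 'I_n), 0 <= p n i j <= 1)
    (psym : forall (n : nat) (i j : 'I_n), p n i j = p n j i)
    (GER : forall n : nat, inhomogeneous_ER P (p n) (G n))
    (alpha0 : alpha n @[n --> \oo] --> (0 : R))
    (nalpha : n%:R * alpha n @[n --> \oo] --> +oo)
    (psum : forall eps : R, 0 < eps -> \forall n \near \oo, forall j : 'I_n,
      `|\sum_(i < n) p n i j - n%:R * alpha n| <= eps * (n%:R * alpha n))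
    (C1 : 1 <= C)
    (pmax : forall (n : nat) (i j : 'I_n), p n i j <= C * alpha n) :
  {ae P, forall w : Omega,
    weak_cvg
      (fun n : nat =>
        esd (((Num.sqrt (n%:R * alpha n))^-1)%:C *: adjacency R (G n w)))
      (@semicircle_cdf R)}.
Proof. exact: (ae_weak_cvg_semicircle p01 psym GER alpha0 nalpha psum C1 pmax). Qed.
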